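(* Let $N\ge 2$, and let $Q,B$ be real constant $N\times N$ matrices with $Q=Q^\star\ge 0$, such that $K(t)=\frac1t\int_0^t e^{sB}Qe^{sB^\star}ds$ is positive definite for every $t>0$. Let $\mathscr A u=\operatorname{tr}(Q\nabla^2u)+\langle BX,\nabla u\rangle$ be the associated operator on $\mathbb R^N$, with volume function $V(t)$, intrinsic dimensions $D_0$ (at zero) and $D_\infty$ (at infinity), Besov spaces $\mathfrak B^{\mathscr A}_{2s,1}$, seminorm $\mathscr N^{\mathscr A}_{2s,1}$ and $s$-perimeter $\mathfrak P_{\mathscr A,s}$ as defined in the context. Let $0<s<\frac12$, and assume $\operatorname{tr}B\ge0$ and $D_0>D_\infty$. Suppose there exists $\gamma>0$ such that $$V(t)\ge\gamma\min\{t^{D_0/2},t^{D_\infty/2}\}\qquad\text{for all }t>0.$$ Then $\mathfrak B^{\mathscr A}_{2s,1}\hookrightarrow L^{\frac{D_0}{D_0-2s}}+L^{\frac{D_\infty}{D_\infty-2s}}$. More precisely, there exists a constant $c>0$, depending only on $N,D_0,D_\infty,s,\gamma$, such that for every $f\in\mathfrak B^{\mathscr A}_{2s,1}$ one has $$\|f\|_{L^{\frac{D_0}{D_0-2s}}+L^{\frac{D_\infty}{D_\infty-2s}}}\le\frac1c\,\mathscr N^{\mathscr A}_{2s,1}(f).$$ Moreover, there exists a constant $\tilde c>0$, depending only on $N,D_0,D_\infty,s,\gamma$, such that for any measurable set $E\subset\mathbb R^N$ with $|E|<\infty$ one has $$\mathfrak P_{\mathscr A,s}(E)\ge\tilde 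c\,\min\left\{|E|^{\frac{D_0-2s}{D_0}},|E|^{\frac{D_\infty-2s}{D_\infty}}\right\}.$$
   Context: Lebesgue measure on $\mathbb R^N$ is denoted $|\cdot|$, $\omega_N$ is the Lebesgue measure of the unit ball of $\mathbb R^N$, $L^p=L^p(\mathbb R^N,dX)$, $X$ denotes the generic point of $\mathbb R^N$, and $B^\star$ is the transpose of $B$. Volume function: $V(t)=\omega_N\,(\det(tK(t)))^{1/2}$ for $t>0$. Intrinsic dimension at zero: it is known that there is a (unique) number $D_0\ge N$ such that $V(t)\cong t^{D_0/2}$ as $t\to0^+$ (i.e. the ratio $V(t)/t^{D_0/2}$ stays between two positive constants for small $t>0$); this number is $D_0$. Intrinsic dimension at infinity: $D_\infty=\sup\Sigma_\infty$, where $\Sigma_\infty=\left\{\alpha>0\;:\;\int_1^\infty\frac{t^{\frac\alpha2-1}}{V(t)}dt<\infty\right\}$. It is known that $2\le D_\infty\le\infty$ when $\operatorname{tr}B\ge0$. Heat kernel and semigroup: for $X,Y\in\mathbb R^N$ and $t>0$ let $m_t(X,Y)=\sqrt{\langle K(t)^{-1}(Y-e^{tB}X),Y-e^{tB}X\rangle}$ and $$p(X,Y,t)=\frac{\omega_N(4\pi)^{-N/2}}{V(t)}\exp\left(-\frac{m_t(X,Y)^2}{4t}\right),\qquad P_tf(X)=\int_{\mathbb R^N}p(X,Y,t)f(Y)\,dY.$$ Besov space: for $0<\alpha<1$ and $1\le p<\infty$, $\mathfrak B^{\mathscr A}_{\alpha,p}$ is the set of all $f\in L^p$ such that $$\mathscr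 N^{\mathscr A}_{\alpha,p}(f)=\left(\int_0^\infty\frac{1}{t^{\frac{\alpha p}{2}+1}}\int_{\mathbb R^N}P_t\left(|f-f(X)|^p\right)(X)\,dX\,dt\right)^{1/p}<\infty,$$ where $P_t(|f-f(X)|^p)(X)=\int_{\mathbb R^N}p(X,Y,t)|f(Y)-f(X)|^p\,dY$. $s$-perimeter: for $0<s<\frac12$ and $E\subset\mathbb R^N$ measurable, $E$ has finite $s$-perimeter if $\mathbf 1_E\in\mathfrak B^{\mathscr A}_{2s,1}$, and $\mathfrak P_{\mathscr A,s}(E)=\mathscr N^{\mathscr A}_{2s,1}(\mathbf 1_E)$, where $\mathbf 1_E$ is the indicator function of $E$. If $|E|<\infty$ and $\mathbf 1_E\notin\mathfrak B^{\mathscr A}_{2s,1}$ then $\mathfrak P_{\mathscr A,s}(E)=\mathscr N^{\mathscr A}_{2s,1}(\mathbf 1_E)=+\infty$. Sum space: $L^{q_0}+L^{q_\infty}$ is the Banach space of functions $f=f_1+f_2$ with $f_1\in L^{q_0}$, $f_2\in L^{q_\infty}$, with norm $\|f\|_{L^{q_0}+L^{q_\infty}}=\inf\{\|f_1\|_{q_0}+\|f_2\|_{q_\infty}: f=f_1+f_2,\ f_1\in L^{q_0},\ f_2\in L^{q_\infty}\}$. *)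

(* Defs.v *)
From HB Require Import structures.
From mathcomp Require Import all_boot all_order all_algebra.
From mathcomp Require Import all_classical all_reals all_analysis.

Set Implicit Arguments.
Unset Strict Implicit.
Unset Printing Implicit Defensive.
Import Order.TTheory GRing.Theory Num.Theory.
Import numFieldNormedType.Exports.

Local Open Scope classical_set_scope.
Local Open Scope ring_scope.

Section cons_measure.
Context {R : realType} {n : nat}.
Local Notation M := (measurableTypeR R).
Context (mu : {sigma_finite_measure set (n.-tuple M) -> \bar R}).
Local Open Scope ereal_scope.

Definition consT (z : M * n.-tuple M) : n.+1.-tuple M := [tuple of z.1 :: z.2].

Lemma measurable_consT : measurable_fun [set: M * n.-tuple M] consT.
Proof. exact: (measurable_cons measurable_fst measurable_snd). Qed.

Definition cons_measure : set (n.+1.-tuple M) -> \bar R :=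
  pushforward (lebesgue_measure \x mu) consT.

Let cons_measure0 : cons_measure set0 = 0.
Proof. by rewrite /cons_measure /pushforward preimage_set0 measure0. Qed.

Let cons_measure_ge0 A : 0 <= cons_measure A.
Proof. by rewrite /cons_measure /pushforward measure_ge0. Qed.

Let cons_measure_sigma_additive : semi_sigma_additive cons_measure.
Proof.
move=> F mF tF mUF; rewrite /cons_measure /pushforward preimage_bigcup.
have mpre (A : set (n.+1.-tuple M)) : measurable A ->
    measurable (consT @^-1` A).
  by move=> mA; rewrite -[X in measurable X]setTI; exact: measurable_consT.
apply: measure_semi_sigma_additive.
- by move=> k; exact: mpre.
- apply/trivIsetP => /= i j _ _ ij; rewrite -preimage_setI.
  by move/trivIsetP : tF => /(_ _ _ _ _ ij) ->//; rewrite preimage_set0.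
- by rewrite -preimage_bigcup; exact: mpre.
Qed.

HB.instance Definition _ := isMeasure.Build _ _ _ cons_measure
  cons_measure0 cons_measure_ge0 cons_measure_sigma_additive.

Let cons_measure_sigma_finite : sigma_finite setT cons_measure.
Proof.
have /sigma_finiteP[F [TF ndF Foo]] := sigma_finiteT (@lebesgue_measure R).
have /sigma_finiteP[G [TG ndG Goo]] := sigma_finiteT mu.
pose uncons (t : n.+1.-tuple M) := (thead t, [tuple of behead t]).
have muncons : measurable_fun [set: n.+1.-tuple M] uncons.
  apply/measurable_fun_pairP; split; first exact: measurable_tnth.
  exact: measurable_behead.
have consTK : cancel consT uncons.
  by move=> [x t]; rewrite /uncons/= theadE; congr (_, _); exact/val_inj.
exists (fun k => uncons @^-1` (F k `*` G k)).
  apply/seteqP; split=> [t _|//].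
  have : setT (uncons t).1 by []. rewrite TF => -[i _ Fi].
  have : setT (uncons t).2 by []. rewrite TG => -[j _ Gj].
  exists (maxn i j) => //; split.
  - by apply: (subsetPset _ _ (ndF _ _ (leq_maxl i j))).
  - by apply: (subsetPset _ _ (ndG _ _ (leq_maxr i j))).
move=> k; have [mFk Fkoo] := Foo k; have [mGk Gkoo] := Goo k; split.
  by rewrite -[X in measurable X]setTI; apply: muncons => //; exact: measurableX.
rewrite /cons_measure /pushforward -comp_preimage.
rewrite (_ : uncons \o consT = id); last exact/funext/consTK.
by rewrite preimage_id product_measure1E// lte_mul_pinfty// ge0_fin_numE.
Qed.

HB.instance Definition _ := Measure_isSigmaFinite.Build _ _ _ cons_measure
  cons_measure_sigma_finite.

End cons_measure.

(* n-fold product of the one-dimensional Lebesgue measure on the Borel sets. *)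
Fixpoint borel_lebesgue (R : realType) (n : nat) :
    {sigma_finite_measure set (n.-tuple (measurableTypeR R)) -> \bar R} :=
  if n is m.+1 then cons_measure (borel_lebesgue R m)
  else dirac [tuple].

Lemma borel_lebesgue_box (R : realType) (n : nat) (A : 'I_n -> set R) :
  (forall i, measurable (A i)) ->
  (borel_lebesgue R n [set x | forall i, A i (tnth x i)] =
  \prod_(i < n) lebesgue_measure (A i))%E.
Proof.
elim: n A => [A _|n IH A mA].
  by rewrite big_ord0 /= /dirac indicE mem_set//= => -[].
rewrite big_ord_recl -IH// /= /cons_measure /pushforward.
rewrite (_ : _ @^-1` _ =
  A ord0 `*` [set x | forall i, A (lift ord0 i) (tnth x i)]); last first.
  apply/seteqP; split => -[x t] /=.
    by move=> h; split=> [|i]; [have := h ord0|have := h (lift ord0 i); rewrite tnthS].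
  move=> [h0 hS] i; have [j ->|->//] := unliftP ord0 i.
  by rewrite tnthS.
have mB : measurable ([set x | forall i, A (lift ord0 i) (tnth x i)] :
    set (n.-tuple (measurableTypeR R))).
  rewrite [X in measurable X](_ : _ =
      \bigcap_i ((@tnth n (measurableTypeR R) ^~ i) @^-1` (A (lift ord0 i)))).
    apply: fin_bigcap_measurable => // i _.
    by rewrite -[X in measurable X]setTI; apply: measurable_tnth => //; exact: mA.
  by apply/seteqP; split => t /= h i; [move=> _; exact: h|exact: (h i)].
by rewrite product_measure1E//; exact: mA.
Qed.

(* R^N with the sigma-algebra of Lebesgue measurable sets, i.e. the Caratheodory
   sets of the outer measure of the N-fold Borel product measure. *)
Definition Rn (R : realType) (N : nat) : measurableType _ :=
  caratheodory_type (mu_ext (borel_lebesgue R N)).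

Definition lebesgue_Rn (R : realType) (N : nat) :
    {measure set (Rn R N) -> \bar R} :=
  @completed_measure_extension _ _ _ (borel_lebesgue R N).

Definition colv (R : realType) (N : nat) (X : Rn R N) : 'cV[R]_N :=
  \col_i (tnth X i : R).

Definition dotv (R : realType) (N : nat) (u v : 'cV[R]_N) : R :=
  \sum_i u i 0 * v i 0.

Definition unit_ball (R : realType) (N : nat) : set (Rn R N) :=
  [set X | dotv (colv X) (colv X) < 1].

Definition omega (R : realType) (N : nat) : R :=
  fine (lebesgue_Rn R N (@unit_ball R N)).

Definition psdmx (R : realType) (N : nat) (M : 'M[R]_N) : Prop :=
  forall u : 'cV[R]_N, 0 <= dotv (M *m u) u.

Definition pdmx (R : realType) (N : nat) (M : 'M[R]_N) : Prop :=
  forall u : 'cV[R]_N, u != 0 -> 0 < dotv (M *m u) u.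

Definition expmx (R : realType) (N : nat) (A : 'M[R]_N) : 'M[R]_N :=
  limn (series (fun k : nat => (k`!%:R)^-1 *: A ^+ k)).

(* The operator tr(Q Hess u) + <BX, grad u> enters only through (Q, B), so every
   notion attached to it below is parameterized by these two matrices. *)
Definition Kmx (R : realType) (N : nat) (Q B : 'M[R]_N) (t : R) : 'M[R]_N :=
  t^-1 *: \matrix_(i, j) \int[lebesgue_measure]_(r in `[0, t])
    ((expmx (r *: B) *m Q *m expmx (r *: B^T)) i j).

Definition vol (R : realType) (N : nat) (Q B : 'M[R]_N) (t : R) : R :=
  omega R N * Num.sqrt (\det (t *: Kmx Q B t)).

(* "D0 is the intrinsic dimension at zero of (Q, B)"; such a D0 is unique. *)
Definition dim_zero (R : realType) (N : nat) (Q B : 'M[R]_N) (D0 : R) : Prop :=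
  N%:R <= D0 /\
  exists c C : R, [/\ 0 < c, 0 < C &
    \forall t \near 0^'+, c <= vol Q B t / t `^ (D0 / 2) <= C].

Definition Sigma_infty (R : realType) (N : nat) (Q B : 'M[R]_N) : set R :=
  [set a | 0 < a /\
    (\int[lebesgue_measure]_(t in `[1%R, +oo[)
       ((t `^ (a / 2 - 1) / vol Q B t)%R)%:E < +oo)%E].

Definition dim_infty (R : realType) (N : nat) (Q B : 'M[R]_N) : \bar R :=
  ereal_sup [set a%:E | a in Sigma_infty Q B].

Definition kernel_dist (R : realType) (N : nat) (Q B : 'M[R]_N) (t : R)
    (X Y : Rn R N) : R :=
  let v := colv Y - expmx (t *: B) *m colv X in
  Num.sqrt (dotv (invmx (Kmx Q B t) *m v) v).

Definition heat_kernel (R : realType) (N : nat) (Q B : 'M[R]_N)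
    (X Y : Rn R N) (t : R) : R :=
  omega R N * (4 * pi) `^ (- (N%:R / 2)) / vol Q B t *
  expR (- (kernel_dist Q B t X Y ^+ 2 / (4 * t))).

Definition heat_semigroup (R : realType) (N : nat) (Q B : 'M[R]_N) (t : R)
    (g : Rn R N -> R) (X : Rn R N) : \bar R :=
  (\int[lebesgue_Rn R N]_Y (heat_kernel Q B X Y t * g Y)%:E)%E.

Definition besov_seminorm (R : realType) (N : nat) (Q B : 'M[R]_N)
    (alpha p : R) (f : Rn R N -> R) : \bar R :=
  ((\int[lebesgue_measure]_(t in `]0%R, +oo[)
     (((t `^ (alpha * p / 2 + 1))^-1)%:E *
      \int[lebesgue_Rn R N]_X
        heat_semigroup Q B t (fun Y => `|f Y - f X| `^ p)%R X)) `^ p^-1)%E.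

Definition besov (R : realType) (N : nat) (Q B : 'M[R]_N) (alpha p : R) :
    set (Rn R N -> R) :=
  [set f | f \in Lfun (lebesgue_Rn R N) p%:E /\
           (besov_seminorm Q B alpha p f < +oo)%E].

(* The value +oo is taken exactly when the indicator of E, supposed integrable,
   is not in the Besov space. *)
Definition perimeter (R : realType) (N : nat) (Q B : 'M[R]_N) (s : R)
    (E : set (Rn R N)) : \bar R :=
  besov_seminorm Q B (2 * s) 1 (\1_E).

Definition sum_decomposition (R : realType) (N : nat) (q0 q1 : R)
    (f : Rn R N -> R) : set ((Rn R N -> R) * (Rn R N -> R)) :=
  [set g | [/\ g.1 \in Lfun (lebesgue_Rn R N) q0%:E,
               g.2 \in Lfun (lebesgue_Rn R N) q1%:E &
               f = g.1 \+ g.2 %[ae lebesgue_Rn R N]]].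

Definition sum_space (R : realType) (N : nat) (q0 q1 : R) :
    set (Rn R N -> R) :=
  [set f | sum_decomposition q0 q1 f !=set0].

Definition sum_norm (R : realType) (N : nat) (q0 q1 : R) (f : Rn R N -> R) :
    \bar R :=
  ereal_inf [set ('N[lebesgue_Rn R N]_(q0%:E)[EFin \o g.1] +
                  'N[lebesgue_Rn R N]_(q1%:E)[EFin \o g.2])%E
            | g in sum_decomposition q0 q1 f].

(* Main.v *)
From HB Require Import structures.
Require Import Defs.
From mathcomp Require Import all_boot all_order all_fingroup all_algebra.
From mathcomp Require Import all_classical all_reals all_analysis.
From mathcomp Require Import measurable_realfun.
From mathcomp Require Import ring lra.

(* The heat kernel p(X, ., t) is a probability density bounded by kappa / V(t).
   Hence, as soon as |{g > g(X) / 2}| <= V(t) / (2 kappa), it puts mass at least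
   1/2 on {g <= g(X) / 2}, so that \int p(X, Y, t) |g(Y) - g(X)| dY >= g(X) / 4.
   If V(t) >= c t^(D/2) on the relevant range of times and J = \int g^q with
   q = D / (D - 2 s), then by Chebyshev's inequality this happens at all times
   t >= tau(X), where tau(X)^(D/2) is of order J / g(X)^q; integrating against
   t^(-s-1) dt, in time first, gives \int g^q J^(-(q-1)/q) <= C N(g), that is
   |g|_q <= C N(g), with no coarea formula.  For D_0 > D_infty one splits f at
   the level where its distribution function crosses gamma / (2 kappa): the part
   above the level only sees D_0, the part below only D_infty.  Indicators give
   the isoperimetric inequality.

   The exponents make sense because D_infty >= N > 2 s: t K(t) = C(t) satisfies
   C(2t) = C(t) + e^(tB) C(t) e^(tB)^T with det e^(tB) = e^(t tr B) >= 1, and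
   comparing Gaussian integrals yields det C(2t) >= 2^N det C(t), so V(t) grows
   at least like t^(N/2). *)

Set Implicit Arguments.
Unset Strict Implicit.
Unset Printing Implicit Defensive.
Import Order.TTheory GRing.Theory Num.Theory.
Import numFieldNormedType.Exports.

Local Open Scope classical_set_scope.
Local Open Scope ring_scope.

(** * Integration preliminaries *)

Section real_powers.
Context (R : realType).
Implicit Types a r x y : R.

Lemma ler_ppowR2r r x y : 0 < r -> 0 <= x -> 0 <= y ->
  (x `^ r <= y `^ r) = (x <= y).
Proof. by move=> r0 x0 y0; apply: (le_mono_in (gt0_ltr_powR r0)). Qed.

Lemma sqrt_exprn x n : 0 <= x -> Num.sqrt (x ^+ n) = x `^ (n%:R / 2).
Proof.
by move=> x0; rewrite -powR12_sqrt ?exprn_ge0// -powR_mulrn// -powRrM.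
Qed.

Lemma is_derive_powRN r x : 0 < r -> 0 < x ->
  is_derive x (1 : R) (fun y => - (y `^ (- r) / r)) (x `^ (- (r + 1))).
Proof.
move=> r0 x0.
have -> : (fun y => - (y `^ (- r) / r)) = - r^-1 *: (fun y : R => y `^ (- r)).
  by apply/funext => y; rewrite mulrC -mulNr.
have dx := is_derive1_powR (- r) x0; apply: is_derive_eq.
by rewrite /GRing.scale/= mulrA mulrNN mulVf ?gt_eqF// mul1r opprD.
Qed.

Lemma cvg_powRN_pinfty r : 0 < r -> x `^ (- r) @[x --> +oo] --> 0.
Proof.
move=> r0; apply/cvgrPdist_le => e e0; near=> x.
have x0 : 0 < x by near: x; exact: nbhs_pinfty_gt.
have ex : e `^ (- r^-1) <= x.
  by near: x; apply: nbhs_pinfty_ge; rewrite num_real.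
rewrite sub0r normrN ger0_norm ?powR_ge0// powRN invf_ple ?posrE ?powR_gt0//.
have -> : e^-1 = (e `^ (- r^-1)) `^ r.
  by rewrite -powRrM mulNr mulVf ?gt_eqF// powR_inv1// ltW.
by rewrite ler_ppowR2r// ?powR_ge0 ?ltW.
Unshelve. all: by end_near. Qed.

Lemma integral_powRN_itvcy a r : 0 < a -> 0 < r ->
  (\int[lebesgue_measure]_(t in `[a, +oo[) (t `^ (- (r + 1)))%:E =
   (a `^ (- r) / r)%:E)%E.
Proof.
move=> a0 r0; pose F x := - (x `^ (- r) / r).
have cF x : 0 < x -> {for x, continuous F}.
  move=> x0; apply/differentiable_continuous/derivable1_diffP.
  by have [] := is_derive_powRN r0 x0.
rewrite (@ge0_continuous_FTC2y R _ F a 0).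
- by rewrite -EFinB sub0r opprK.
- by move=> x _; exact: powR_ge0.
- apply: continuous_in_subspaceT => x; rewrite inE/= in_itv/= andbT => ax.
  apply/differentiable_continuous/derivable1_diffP.
  by have [] := is_derive1_powR (- (r + 1)) (lt_le_trans a0 ax).
- rewrite -oppr0 -(mul0r r^-1); apply: cvgN; apply: cvgMr_tmp.
  exact: cvg_powRN_pinfty.
- by move=> x ax; have [] := is_derive_powRN r0 (lt_trans a0 ax).
- exact/cvg_at_right_filter/cF.
- move=> x; rewrite in_itv/= andbT => ax.
  by rewrite derive1E; have [_ ->] := is_derive_powRN r0 (lt_trans a0 ax).
Qed.

(* For [a = 0] the integral diverges and the left-hand side is [0 `^ (- r) = 0]. *)
Lemma integral_powRN_tail_ge a r : 0 <= a -> 0 < r ->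
  ((a `^ (- r) / r)%:E <= \int[lebesgue_measure]_t
     (if (0 < t) && (a <= t) then t `^ (- (r + 1)) else 0)%:E)%E.
Proof.
move=> a_ge0 r0.
have [a0|a0] := eqVneq a 0.
  rewrite {1}a0 powR0 ?oppr_eq0 ?gt_eqF// mul0r.
  by apply: integral_ge0 => t _; rewrite lee_fin; case: ifP; rewrite ?powR_ge0.
have {}a0 : 0 < a by rewrite lt_neqAle eq_sym a0.
rewrite -integral_powRN_itvcy// integral_mkcond le_eqVlt; apply/orP; left.
apply/eqP/eq_integral => t _; rewrite /patch.
have -> : (t \in [set` `[a, +oo[]) = (0 < t) && (a <= t).
  apply/idP/andP => [|[t0 ta]]; rewrite inE/= in_itv/= andbT // => ta.
  by rewrite (lt_le_trans a0 ta).
by case: ifP.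
Qed.

End real_powers.

Section min_and_clamp.
Context (R : realDomainType).
Implicit Types u v c l : R.

Definition clamp c u : R := Num.max (- c) (Num.min u c).

Lemma min_increment c u v : u <= v ->
  Num.min u c <= Num.min v c <= Num.min u c + (v - u).
Proof.
move=> uv; case: (leP u c) => uc; case: (leP v c) => vc; apply/andP; split; lra.
Qed.

Lemma min_lipschitz c u v : `|Num.min u c - Num.min v c| <= `|u - v|.
Proof.
wlog uv : u v / u <= v.
  move=> le_case; case/orP: (le_total u v) => [/le_case//|/le_case].
  by rewrite distrC [`|v - u|]distrC.
have /andP[min_ge min_le] := min_increment c uv.
by rewrite distrC [leRHS]distrC !ger0_norm ?subr_ge0// lerBlDl.
Qed.

Lemma sub_min_lipschitz c u v :
  `|(u - Num.min u c) - (v - Num.min v c)| <= `|u - v|.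
Proof.
wlog uv : u v / u <= v.
  move=> le_case; case/orP: (le_total u v) => [/le_case//|/le_case].
  by rewrite distrC [`|v - u|]distrC.
have /andP[min_ge min_le] := min_increment c uv.
by rewrite distrC [leRHS]distrC !ger0_norm ?subr_ge0//; lra.
Qed.

Lemma normr_clamp c u : 0 <= c -> `|clamp c u| = Num.min `|u| c.
Proof.
rewrite /clamp => c0; have [u0|u0] := ger0P u.
  have m0 : 0 <= Num.min u c by rewrite le_min u0.
  by rewrite (max_idPr _) ?ger0_norm//; lra.
rewrite (min_idPl _); last lra.
have [uc|uc] := leP (- c) u; first by rewrite ltr0_norm// (min_idPl _)//; lra.
by rewrite normrN ger0_norm// (min_idPr _)//; lra.
Qed.

Lemma normr_sub_clamp c u : 0 <= c -> `|u - clamp c u| = `|u| - Num.min `|u| c.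
Proof.
rewrite /clamp => c0; have [u0|u0] := ger0P u.
  have m0 : 0 <= Num.min u c by rewrite le_min u0.
  by rewrite (max_idPr _) ?ger0_norm ?subr_ge0 ?ge_min ?lexx//; lra.
rewrite (min_idPl _); last lra.
have [uc|uc] := leP (- c) u.
  by rewrite subrr normr0 (min_idPl _) ?subrr//; lra.
by rewrite (min_idPr _) ?ltr0_norm; lra.
Qed.

End min_and_clamp.

Section superlevel_sets.
Context (T : Type) (R : realDomainType).
Implicit Types (f : T -> R) (l c : R).

Definition superlevel f l : set T := [set x | l < f x].

Lemma superlevel_min f c l :
  superlevel (fun x => Num.min (f x) c) l = if l < c then superlevel f l else set0.
Proof.
rewrite /superlevel; case: ifPn => lc; apply/seteqP; split => x //=;
  by rewrite lt_min ?lc ?(negbTE lc) ?andbT ?andbF.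
Qed.

Lemma superlevel_sub_min f c l : 0 <= l ->
  superlevel (fun x => f x - Num.min (f x) c) l = superlevel f (l + c).
Proof.
move=> l0; apply/seteqP; split => x; rewrite /superlevel/=;
  by case: (leP (f x) c) => fc; lra.
Qed.

Lemma superlevel_indic (E : set T) l : 0 <= l ->
  superlevel (\1_E : T -> R) l = if l < 1 then E else set0.
Proof.
move=> l0; apply/seteqP; split => x; rewrite /superlevel/= indicE.
  case: (boolP (x \in E)) => /= [/set_mem Ex ->//|_].
  by rewrite ltNge l0.
by case: ifP => // l1 Ex; rewrite mem_set.
Qed.

End superlevel_sets.

Section integration.
Context (d : measure_display) (T : measurableType d) (R : realType).
Variable mu : {measure set T -> \bar R}.
Local Open Scope ereal_scope.
Implicit Types (g : T -> R) (q l : R).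

(* Unlike [ge0_le_integral], no measurability is needed: the integral of a
   nonnegative function is a supremum over the simple functions below it. *)
Lemma ge0_le_integral_nomeas (D : set T) (f h : T -> \bar R) :
  (forall x, D x -> 0 <= f x) -> (forall x, D x -> f x <= h x) ->
  \int[mu]_(x in D) f x <= \int[mu]_(x in D) h x.
Proof.
move=> f0 fh; have h0 x : D x -> 0 <= h x.
  by move=> Dx; apply: le_trans (fh _ Dx); exact: f0.
rewrite !ge0_integralE//; apply: ge_ereal_sup => _ [k kf <-].
apply: ereal_sup_ubound; exists k => // x; apply: le_trans (kf x) _.
by rewrite /patch; case: ifPn => // /set_mem; exact: fh.
Qed.

Lemma measurable_superlevel g l :
  measurable_fun setT g -> measurable (superlevel g l).
Proof.
move=> mg; rewrite -[X in measurable X]setTI.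
have -> : superlevel g l = g @^-1` `]l, +oo[.
  by apply/seteqP; split => x /=; rewrite in_itv/= andbT.
by apply: mg => //; exact: measurable_itv.
Qed.

Lemma ge0_chebyshev g q l :
  measurable_fun setT g -> (forall x, 0 <= g x)%R -> (0 < q)%R -> (0 < l)%R ->
  (l `^ q)%:E * mu (superlevel g l) <= \int[mu]_x (g x `^ q)%:E.
Proof.
move=> mg g0 q0 l0; have mE := measurable_superlevel l mg.
rewrite -(integral_cst mu mE) integral_mkcond.
apply: ge0_le_integral_nomeas => x _; rewrite /patch.
  by case: ifP => // _; rewrite lee_fin powR_ge0.
case: ifPn => [/set_mem lg|_]; rewrite lee_fin ?powR_ge0//.
by rewrite ler_ppowR2r// ltW.
Qed.

Lemma Lnorm_powR g q : (forall x, 0 <= g x)%R ->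
  'N[mu]_(q%:E)[EFin \o g] = (\int[mu]_x (g x `^ q)%:E) `^ q^-1.
Proof.
move=> g0; rewrite unlock; apply: (congr1 (fun z => z `^ q^-1)).
by apply: eq_integral => x _; rewrite /= ger0_norm.
Qed.

Lemma Lnorm_indic (E : set T) q : measurable E -> (0 < q)%R ->
  'N[mu]_(q%:E)[EFin \o \1_E] = mu E `^ q^-1.
Proof.
move=> mE q0; rewrite Lnorm_powR//; congr (_ `^ _).
rewrite -[X in _ = mu X]setIT -integral_indic//; apply: eq_integral => x _.
by rewrite indicE; case: (x \in E); rewrite ?powR1 ?powR0 ?gt_eqF.
Qed.

Lemma integral_minr_powR_lty g q (c : R) : (1 <= q)%R ->
  measurable_fun setT g -> (forall x, 0 <= g x)%R -> (0 <= c)%R ->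
  \int[mu]_x (g x)%:E < +oo -> \int[mu]_x (Num.min (g x) c `^ q)%:E < +oo.
Proof.
move=> q1 mg g0 c0 gfin.
apply: (@le_lt_trans _ _ (\int[mu]_x ((c `^ (q - 1))%:E * (g x)%:E))).
  apply: ge0_le_integral_nomeas => x _; first by rewrite lee_fin powR_ge0.
  have m0 : (0 <= Num.min (g x) c)%R by rewrite le_min g0.
  rewrite -EFinM lee_fin -mulr_powRB1 ?(lt_le_trans ltr01)// mulrC.
  apply: ler_pM; rewrite ?powR_ge0 ?ge_min ?lexx//.
  by apply: ge0_ler_powR; rewrite ?nnegrE ?subr_ge0 ?ge_min ?lexx ?orbT.
rewrite ge0_integralZl_EFin ?powR_ge0//.
- by apply: lte_mul_pinfty => //; rewrite lee_fin powR_ge0.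
- by move=> x _; rewrite lee_fin.
- exact/measurable_EFinP.
Qed.

Lemma Lnorm_le_minr g q (M : \bar R) : (0 < q)%R ->
  measurable_fun setT g -> (forall x, 0 <= g x)%R ->
  (forall n : nat, 'N[mu]_(q%:E)[EFin \o (fun x => Num.min (g x) n%:R)] <= M) ->
  'N[mu]_(q%:E)[EFin \o g] <= M.
Proof.
move=> q0 mg g0 gM; pose gn (n : nat) x := Num.min (g x) n%:R.
have gn0 n x : (0 <= gn n x)%R by rewrite le_min g0 ler0n.
have gn_nd x : {homo (fun n => (gn n x `^ q)%:E) : m n / (m <= n)%N >-> m <= n}.
  move=> m n mn; rewrite lee_fin ler_ppowR2r//.
  by rewrite /gn le_min !ge_min lexx/= ler_nat mn orbT.
have gn_cvg x : limn (fun n => (gn n x `^ q)%:E) = (g x `^ q)%:E.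
  apply/cvg_lim => //; apply: cvg_near_cst; near=> n; congr (_ `^ _)%:E.
  by apply/min_idPl; near: n; exact: nbhs_infty_ger.
have M0 : 0 <= M by apply: le_trans (gM 0%N); exact: Lnorm_ge0.
have int_gn n : \int[mu]_x (gn n x `^ q)%:E <= M `^ q.
  have -> : \int[mu]_x (gn n x `^ q)%:E = 'N[mu]_(q%:E)[EFin \o gn n] `^ q.
    rewrite Lnorm_powR// -poweRrM mulVf ?gt_eqF// poweRe1//.
    by apply: integral_ge0 => x _; rewrite lee_fin powR_ge0.
  apply: gt0_ler_poweR; rewrite ?in_itv/= ?leey ?Lnorm_ge0 ?M0 ?(ltW q0)//.
  exact: gM.
have int_g : \int[mu]_x (g x `^ q)%:E <= M `^ q.
  rewrite -(eq_integral _ _ (fun x _ => gn_cvg x)) monotone_convergence//.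
  - apply: lime_le; last exact: nearW.
    apply: ereal_nondecreasing_is_cvgn => m n mn.
    by apply: ge0_le_integral_nomeas => x _; [rewrite lee_fin powR_ge0|exact: gn_nd].
  - move=> n; apply/measurable_EFinP; apply: measurableT_comp (measurable_powR _) _.
    exact: measurable_minr.
  - by move=> n x _; rewrite lee_fin powR_ge0.
rewrite Lnorm_powR// -(poweRe1 M0) -(divff (lt0r_neq0 q0)) poweRrM.
apply: gt0_ler_poweR; rewrite ?invr_ge0 ?(ltW q0)//.
  rewrite in_itv/= leey andbT.
  by apply: integral_ge0 => x _; rewrite lee_fin powR_ge0.
by rewrite in_itv/= leey poweR_ge0.
Unshelve. all: by end_near. Qed.

(* [l0] is the infimum of the levels whose superlevel set has measure at most
   [c]; Chebyshev's inequality shows that there are such levels. *)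
Lemma crossing_level g (c : R) :
  measurable_fun setT g -> (forall x, 0 <= g x)%R ->
  \int[mu]_x (g x)%:E < +oo -> (0 < c)%R ->
  exists l0 : R, [/\ (0 <= l0)%R,
    forall l, (l0 < l)%R -> mu (superlevel g l) <= c%:E &
    forall l, (0 <= l)%R -> (l < l0)%R -> c%:E < mu (superlevel g l)].
Proof.
move=> mg g0 gfin c0.
pose S := [set l : R | (0 <= l)%R /\ mu (superlevel g l) <= c%:E].
have superlevel_le (l l' : R) :
    (l <= l')%R -> mu (superlevel g l') <= mu (superlevel g l).
  move=> ll'; apply: le_measure; rewrite ?inE; [exact: measurable_superlevel..|].
  by move=> x; exact: le_lt_trans.
have S_nonempty : S !=set0.
  have I0 : 0 <= \int[mu]_x (g x)%:E by apply: integral_ge0 => x _; rewrite lee_fin.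
  pose I := fine (\int[mu]_x (g x)%:E).
  have gI : \int[mu]_x (g x)%:E = I%:E by rewrite fineK// ge0_fin_numE.
  have l0 : (0 < I / c + 1)%R by rewrite ltr_wpDl// divr_ge0 ?(ltW c0) ?fine_ge0.
  exists (I / c + 1)%R; split; first exact: ltW.
  have := ge0_chebyshev mg g0 ltr01 l0; rewrite powRr1 ?(ltW l0)//.
  under eq_integral do rewrite powRr1//.
  rewrite gI muleC -lee_pdivlMr// => /le_trans; apply.
  rewrite -EFinM lee_fin ler_pdivrMr// mulrDr mulrCA divff ?gt_eqF//; lra.
have S_lb : has_lbound S by exists 0%R => l [].
exists (inf S); split.
- by apply: lb_le_inf => // l [].
- move=> l /(inf_lt S_nonempty)[l' [_ ml'] l'l]; apply: le_trans ml'.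
  exact/superlevel_le/ltW.
- move=> l l0 linf; rewrite ltNge; apply/negP => ml.
  by move: linf; rewrite ltNge => /negP; apply; exact: ge_inf.
Qed.

End integration.

(** * Nonlocal seminorms of bounded Markov kernels *)

Section nonlocal_seminorm.
Context (d : measure_display) (T : measurableType d) (R : realType).
Variable mu : {sigma_finite_measure set T -> \bar R}.
Implicit Types (p : R -> T -> T -> R) (b : R -> R) (f g : T -> R).
Implicit Types (a D J r s t l : R).

Definition bounded_markov_kernel p b : Prop := forall t : R, 0 < t ->
  [/\ forall x y, 0 <= p t x y, forall x, measurable_fun setT (p t x),
      forall x, (\int[mu]_y (p t x y)%:E = 1)%E & forall x y, p t x y <= b t].

Definition mean_deviation p t f x : \bar R :=
  (\int[mu]_y (p t x y * `|f y - f x|)%:E)%E.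

Definition nonlocal_seminorm p s f : \bar R :=
  (\int[lebesgue_measure]_(t in `]0%R, +oo[)
     (((t `^ (s + 1))^-1)%:E * \int[mu]_x mean_deviation p t f x))%E.

Variables (p : R -> T -> T -> R) (b : R -> R).
Hypothesis kernel_p : bounded_markov_kernel p b.

Lemma mean_deviation_ge0 t f x : 0 < t -> (0 <= mean_deviation p t f x)%E.
Proof.
move=> /kernel_p[p0 _ _ _]; apply: integral_ge0 => y _.
by rewrite lee_fin mulr_ge0.
Qed.

Lemma nonlocal_seminorm_ge0 s f : (0 <= nonlocal_seminorm p s f)%E.
Proof.
apply: integral_ge0 => t; rewrite /= in_itv/= andbT => t0.
apply: mule_ge0; first by rewrite lee_fin invr_ge0 powR_ge0.
by apply: integral_ge0 => x _; exact: mean_deviation_ge0.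
Qed.

Lemma le_nonlocal_seminorm s f g :
  (forall x y, `|f y - f x| <= `|g y - g x|) ->
  (nonlocal_seminorm p s f <= nonlocal_seminorm p s g)%E.
Proof.
move=> fg; apply: ge0_le_integral_nomeas => t; rewrite /= in_itv/= andbT => t0.
  apply: mule_ge0; first by rewrite lee_fin invr_ge0 powR_ge0.
  by apply: integral_ge0 => x _; exact: mean_deviation_ge0.
apply: lee_wpmul2l; first by rewrite lee_fin invr_ge0 powR_ge0.
apply: ge0_le_integral_nomeas => x _; first exact: mean_deviation_ge0.
have [p0 _ _ _] := kernel_p t0.
apply: ge0_le_integral_nomeas => y _; first by rewrite lee_fin mulr_ge0.
by rewrite lee_fin ler_wpM2l.
Qed.

Lemma kernel_mass_setC_ge t (E : set T) x : 0 < t -> measurable E ->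
  ((b t)%:E * mu E <= (2^-1)%:E)%E ->
  ((2^-1)%:E <= \int[mu]_(y in ~` E) (p t x y)%:E)%E.
Proof.
move=> t0 mE bE; have [p0 mp p1 pb] := kernel_p t0.
have pE : (\int[mu]_(y in E) (p t x y)%:E <= (2^-1)%:E)%E.
  apply: le_trans bE; rewrite -(integral_cst mu mE).
  by apply: ge0_le_integral_nomeas => y _; rewrite lee_fin.
have := p1 x; rewrite -(setUv E) ge0_integral_setU//; last 4 first.
- exact: measurableC.
- by rewrite setUv; exact/measurable_EFinP.
- by move=> y _; rewrite lee_fin.
- exact/disj_setPCl.
rewrite -(leeD2lE (x := (2^-1)%:E))// -EFinD.
have -> : 2^-1 + 2^-1 = 1 :> R by field.
by move=> <-; exact: leeD.
Qed.

(* At time [t] the kernel puts mass at least [1/2] on the set where [g] is at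
   most half its value at [x]. *)
Lemma mean_deviation_ge t g x : 0 < t ->
  measurable_fun setT g -> (forall y, 0 <= g y) ->
  ((b t)%:E * mu (superlevel g (g x / 2)) <= (2^-1)%:E)%E ->
  ((g x / 4)%:E <= mean_deviation p t g x)%E.
Proof.
move=> t0 mg g0 bE; have [p0 mp _ _] := kernel_p t0.
set E := superlevel g _ in bE.
have mE : measurable E by exact: measurable_superlevel.
have gx0 : 0 <= g x / 2 by rewrite divr_ge0.
apply: (@le_trans _ _ ((g x / 2)%:E * \int[mu]_(y in ~` E) (p t x y)%:E)%E).
  have -> : g x / 4 = g x / 2 * 2^-1 by field.
  by rewrite EFinM; apply: lee_wpmul2l; [|exact: kernel_mass_setC_ge].
rewrite -ge0_integralZl_EFin//; last 3 first.
- exact: measurableC.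
- by move=> y _; rewrite lee_fin.
- exact/measurable_funTS/measurable_EFinP.
rewrite integral_mkcond; apply: ge0_le_integral_nomeas => y _; rewrite /patch.
  by case: ifPn => // _; rewrite -EFinM lee_fin mulr_ge0.
case: ifPn => [|_]; last by rewrite lee_fin mulr_ge0.
rewrite inE/= /E /superlevel/= => /negP; rewrite -leNgt => gy.
rewrite -EFinM lee_fin mulrC ler_wpM2l// distrC ler_normr; apply/orP; left.
by clear -gy; lra.
Qed.

(* Tonelli: for fixed [x] the times [t >= tau x] contribute
   [\int_tau^oo t^-(s+1) dt = tau^-s / s]. *)
Lemma ge0_integral_after_le s (w tau : T -> R) : 0 < s ->
  measurable_fun setT w -> measurable_fun setT tau ->
  (forall x, 0 <= w x) -> (forall x, 0 <= tau x) ->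
  (\int[mu]_x (w x * (tau x `^ (- s) / s))%:E <=
   \int[lebesgue_measure]_(t in `]0%R, +oo[) (((t `^ (s + 1))^-1)%:E *
     \int[mu]_x (if tau x <= t then w x else 0)%:E))%E.
Proof.
move=> s0 mw mtau w0 tau0.
pose tail (z : measurableTypeR R * T) : R :=
  if (0 < z.1) && (tau z.2 <= z.1) then z.1 `^ (- (s + 1)) else 0.
pose h z := (tail z * w z.2)%:E.
have tail0 z : 0 <= tail z by rewrite /tail; case: ifP; rewrite ?powR_ge0.
have h0 z : (0 <= h z)%E by rewrite lee_fin mulr_ge0.
have mtail : measurable_fun setT tail.
  apply: measurable_fun_ifT => //; last first.
    exact: measurableT_comp (measurable_powR _) measurable_fst.
  apply: measurable_and; first exact: measurable_fun_ltr.
  by apply: measurable_fun_ler => //; exact: measurableT_comp mtau measurable_snd.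
have mh : measurable_fun setT h.
  apply/measurable_EFinP/measurable_funM => //.
  exact: measurableT_comp mw measurable_snd.
apply: (@le_trans _ _ (\int[mu]_x \int[lebesgue_measure]_t h (t, x))%E).
  apply: ge0_le_integral_nomeas => x _.
    by rewrite lee_fin mulr_ge0// divr_ge0 ?powR_ge0 ?(ltW s0).
  rewrite /h; under [leRHS]eq_integral do rewrite EFinM/=.
  rewrite ge0_integralZr ?lee_fin//.
  - by rewrite mulrC EFinM lee_wpmul2r ?lee_fin ?integral_powRN_tail_ge.
  - apply/measurable_EFinP.
    exact: (measurableT_comp mtail (measurable_pair2 _)).
  - by move=> t _; rewrite lee_fin.
rewrite -(@fubini_tonelli _ _ _ _ _ lebesgue_measure mu _ mh h0).
rewrite [leRHS]integral_mkcond.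
apply: ge0_le_integral_nomeas => t _.
  by apply: integral_ge0 => x _; exact: h0.
rewrite /patch; case: ifPn => [/set_mem|]; last first.
  rewrite notin_setE/= in_itv/= andbT => /negP/negPf t0.
  by rewrite integral0_eq// => x _; rewrite /h /tail/= t0 mul0r.
rewrite /= in_itv/= andbT => t0.
rewrite -ge0_integralZl_EFin ?invr_ge0 ?powR_ge0//; last 2 first.
- by move=> x _; rewrite lee_fin; case: ifP.
- apply/measurable_EFinP; apply: measurable_fun_ifT => //.
  exact: measurable_fun_ler.
apply: ge0_le_integral_nomeas => x _; first exact: h0.
rewrite /h /tail/= t0/= -EFinM lee_fin powRN.
by case: ifP; rewrite ?mul0r ?mulr0.
Qed.

Lemma nonlocal_seminorm_ge s g (w tau : T -> R) : 0 < s ->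
  measurable_fun setT w -> measurable_fun setT tau ->
  (forall x, 0 <= w x) -> (forall x, 0 <= tau x) ->
  (forall x t, 0 < t -> tau x <= t -> ((w x)%:E <= mean_deviation p t g x)%E) ->
  (\int[mu]_x (w x * (tau x `^ (- s) / s))%:E <= nonlocal_seminorm p s g)%E.
Proof.
move=> s0 mw mtau w0 tau0 wg.
apply: le_trans (ge0_integral_after_le _ _ _ _ _) _ => //.
apply: ge0_le_integral_nomeas => t; rewrite /= in_itv/= andbT => t0.
  apply: mule_ge0; first by rewrite lee_fin invr_ge0 powR_ge0.
  by apply: integral_ge0 => x _; rewrite lee_fin; case: ifP.
apply: lee_wpmul2l; first by rewrite lee_fin invr_ge0 powR_ge0.
apply: ge0_le_integral_nomeas => x _; first by rewrite lee_fin; case: ifP.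
by case: ifP => tx; [exact: wg|exact: mean_deviation_ge0].
Qed.

Definition sobolev_exponent (D s : R) : R := D / (D - 2 * s).

Definition embedding_const (a D s : R) : R :=
  4 * s * (a * 2 `^ sobolev_exponent D s) `^ (2 * s / D).

(* On the superlevel sets of [g] the kernel behaves as in dimension [D], where
   [b t] is of order [t `^ (- (D / 2))]. *)
Definition superlevel_dim (a D : R) g : Prop := forall l t, 0 < l -> 0 < t ->
  (a%:E * mu (superlevel g l) <= (t `^ (D / 2))%:E)%E ->
  ((b t)%:E * mu (superlevel g l) <= (2^-1)%:E)%E.

(* By Chebyshev's inequality for [J], the integral of [g `^ q], after this time
   at least half of the kernel at a point where [g = r] lies in [g <= r / 2]. *)
Definition spreading_time (a D s J r : R) : R :=
  (a * 2 `^ sobolev_exponent D s * J * r `^ (- sobolev_exponent D s)) `^ (2 / D).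

Lemma sobolev_exponent_gt0 D s : 0 < s -> 2 * s < D -> 0 < sobolev_exponent D s.
Proof. by move=> s0 sD; apply: divr_gt0; lra. Qed.

Lemma sobolev_exponent_ge1 D s : 0 < s -> 2 * s < D -> 1 <= sobolev_exponent D s.
Proof. by move=> s0 sD; rewrite ler_pdivlMr; lra. Qed.

Lemma embedding_const_gt0 a D s : 0 < a -> 0 < s -> 0 < embedding_const a D s.
Proof. by move=> a0 s0; rewrite !mulr_gt0 ?powR_gt0 ?mulr_gt0 ?powR_gt0. Qed.

Lemma spreading_time_powRN a D s J r : let q := sobolev_exponent D s in
  0 < a -> 0 < s -> 2 * s < D -> 0 < J -> 0 <= r ->
  r * spreading_time a D s J r `^ (- s) =
  (a * 2 `^ q) `^ (- (2 * s / D)) * J `^ (- (2 * s / D)) * r `^ q.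
Proof.
move=> q a0 s0 sD J0; have q0 := sobolev_exponent_gt0 s0 sD.
rewrite le_eqVlt => /predU1P[<-|r0].
  by rewrite mul0r powR0 ?mulr0// gt_eqF.
rewrite /spreading_time -powRrM -/q.
have -> : 2 / D * - s = - (2 * s / D) by field; lra.
rewrite 2?powRM ?mulr_ge0 ?powR_ge0 ?(ltW a0) ?(ltW J0)//.
rewrite -powRrM (_ : - q * _ = q - 1); last first.
  by rewrite /q /sobolev_exponent; field; lra.
rewrite -(mulr_powRB1 (ltW r0) q0); ring.
Qed.

Lemma mean_deviation_ge_after_spreading a D s g t x J :
  let q := sobolev_exponent D s in
  0 < a -> 0 < s -> 2 * s < D -> 0 < J -> 0 < t -> 0 < g x ->
  measurable_fun setT g -> (forall y, 0 <= g y) -> superlevel_dim a D g ->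
  (\int[mu]_y (g y `^ q)%:E = J%:E)%E -> spreading_time a D s J (g x) <= t ->
  ((g x / 4)%:E <= mean_deviation p t g x)%E.
Proof.
move=> q a0 s0 sD J0 t0 gx0 mg g0 dim_g gJ late.
have q0 := sobolev_exponent_gt0 s0 sD.
have D_gt0 : 0 < D by lra.
apply: mean_deviation_ge => //; apply: dim_g; rewrite ?divr_gt0//.
set m := mu _; have gx20 : 0 < g x / 2 by rewrite divr_gt0.
have : (((g x / 2) `^ q)%:E * m <= J%:E)%E.
  by rewrite -gJ; exact: ge0_chebyshev.
have : (0 <= m)%E by exact: measure_ge0.
case: m => [r| |]// _; last by rewrite gt0_muley ?lte_fin ?powR_gt0// leye_eq.
rewrite -!EFinM !lee_fin => chebyshev.
apply: (@le_trans _ _ (spreading_time a D s J (g x) `^ (D / 2))); last first.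
  by rewrite ler_ppowR2r ?divr_gt0 ?powR_ge0 ?(ltW t0).
rewrite -powRrM (_ : 2 / D * (D / 2) = 1); last by field; lra.
rewrite powRr1 ?mulr_ge0 ?powR_ge0 ?(ltW a0) ?(ltW J0)//.
rewrite -/q powRN ler_pdivlMr ?powR_gt0// -!mulrA ler_pM2l//.
move: chebyshev; rewrite (_ : _ `^ q = g x `^ q / 2 `^ q); last first.
  by rewrite powRM ?(ltW gx0)// -powR_inv1// -powRrM mulN1r powRN.
by rewrite mulrAC ler_pdivrMr ?powR_gt0// mulrC [J * _]mulrC.
Qed.

Lemma integral_spreading_time a D s g J : let q := sobolev_exponent D s in
  0 < a -> 0 < s -> 2 * s < D -> 0 < J ->
  measurable_fun setT g -> (forall x, 0 <= g x) ->
  (\int[mu]_x (g x `^ q)%:E = J%:E)%E ->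
  (\int[mu]_x (g x / 4 * (spreading_time a D s J (g x) `^ (- s) / s))%:E =
   ((embedding_const a D s)^-1 * J `^ q^-1)%:E)%E.
Proof.
move=> q a0 s0 sD J0 mg g0 gJ; have q0 := sobolev_exponent_gt0 s0 sD.
have C0 := embedding_const_gt0 D a0 s0.
transitivity (\int[mu]_x (((embedding_const a D s)^-1 * J `^ (- (2 * s / D)))%:E *
    (g x `^ q)%:E))%E.
  apply: eq_integral => x _; rewrite -EFinM; congr EFin.
  rewrite mulrACA -invfM spreading_time_powRN// /embedding_const -/q powRN.
  by rewrite !invfM; ring.
rewrite ge0_integralZl_EFin ?mulr_ge0 ?invr_ge0 ?(ltW C0) ?powR_ge0//; last 2 first.
- by move=> x _; rewrite lee_fin powR_ge0.
- by apply/measurable_EFinP; exact: measurableT_comp (measurable_powR _) mg.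
rewrite gJ -EFinM -(mulrA _ _ J); congr (_ * _)%:E.
have q0' : 0 < q^-1 by rewrite invr_gt0.
rewrite -(mulr_powRB1 (ltW J0) q0') mulrC; congr (_ * _ `^ _).
by rewrite /q /sobolev_exponent; field; lra.
Qed.

Lemma nonlocal_embedding_finite a D s g : let q := sobolev_exponent D s in
  0 < a -> 0 < s -> 2 * s < D ->
  measurable_fun setT g -> (forall x, 0 <= g x) -> superlevel_dim a D g ->
  (\int[mu]_x (g x `^ q)%:E < +oo)%E ->
  ('N[mu]_(q%:E)[EFin \o g] <=
   (embedding_const a D s)%:E * nonlocal_seminorm p s g)%E.
Proof.
move=> q a0 s0 sD mg g0 dim_g gfin; have q0 := sobolev_exponent_gt0 s0 sD.
have C0 := embedding_const_gt0 D a0 s0.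
have I0 : (0 <= \int[mu]_x (g x `^ q)%:E)%E.
  by apply: integral_ge0 => x _; rewrite lee_fin powR_ge0.
pose J := fine (\int[mu]_x (g x `^ q)%:E)%E.
have gJ : (\int[mu]_x (g x `^ q)%:E = J%:E)%E by rewrite fineK// ge0_fin_numE.
rewrite Lnorm_powR// gJ poweR_EFin.
have : 0 <= J by exact: fine_ge0.
rewrite le_eqVlt => /predU1P[<-|J0].
  rewrite powR0 ?invr_eq0 ?gt_eqF// mule_ge0 ?nonlocal_seminorm_ge0//.
  by rewrite lee_fin ltW.
have mtau : measurable_fun setT (fun x => spreading_time a D s J (g x)).
  apply: measurableT_comp (measurable_powR _) _; apply: measurable_funM => //.
  exact: measurableT_comp (measurable_powR _) mg.
have := @nonlocal_seminorm_ge s g (fun x => g x / 4)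
  (fun x => spreading_time a D s J (g x)) s0.
rewrite (integral_spreading_time a0 s0 sD J0 mg g0 gJ) => seminorm_ge.
rewrite muleC -lee_pdivrMr// muleC -EFinM.
apply: seminorm_ge => // [|x|x|x t t0 late].
- exact: measurable_funM.
- by rewrite divr_ge0.
- exact: powR_ge0.
have := g0 x; rewrite le_eqVlt => /predU1P[gx0|gx0].
  by rewrite -gx0 mul0r; exact: mean_deviation_ge0.
exact: mean_deviation_ge_after_spreading dim_g gJ late.
Qed.

Lemma superlevel_dim_minr a D g c : superlevel_dim a D g ->
  superlevel_dim a D (fun x => Num.min (g x) c).
Proof.
move=> dim_g l t l0 t0; rewrite superlevel_min; case: ifP => _; first exact: dim_g.
by rewrite measure0 !mule0 lee_fin.
Qed.

Lemma nonlocal_embedding a D s g : let q := sobolev_exponent D s in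
  0 < a -> 0 < s -> 2 * s < D ->
  measurable_fun setT g -> (forall x, 0 <= g x) -> superlevel_dim a D g ->
  (\int[mu]_x (g x)%:E < +oo)%E ->
  ('N[mu]_(q%:E)[EFin \o g] <=
   (embedding_const a D s)%:E * nonlocal_seminorm p s g)%E.
Proof.
move=> q a0 s0 sD mg g0 dim_g gfin.
apply: Lnorm_le_minr (sobolev_exponent_gt0 s0 sD) _ _ _ => // n.
apply: le_trans (_ : (embedding_const a D s)%:E *
    nonlocal_seminorm p s (fun x => Num.min (g x) n%:R) <= _)%E.
  apply: nonlocal_embedding_finite => //.
  - exact: measurable_minr.
  - by move=> x; rewrite le_min g0 ler0n.
  - exact: superlevel_dim_minr.
  - exact: integral_minr_powR_lty (sobolev_exponent_ge1 s0 sD) _ _ _ _.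
apply: lee_wpmul2l; first by rewrite lee_fin ltW// embedding_const_gt0.
by apply: le_nonlocal_seminorm => x y; exact: min_lipschitz.
Qed.

Lemma nonlocal_embedding_contraction a D s f g : let q := sobolev_exponent D s in
  0 < a -> 0 < s -> 2 * s < D ->
  measurable_fun setT g -> (\int[mu]_x `|f x|%:E < +oo)%E ->
  (forall x, `|g x| <= `|f x|) ->
  (forall x y, `| `|g y| - `|g x| | <= `|f y - f x|) ->
  superlevel_dim a D (fun x => `|g x|) ->
  ('N[mu]_(q%:E)[EFin \o g] <=
   (embedding_const a D s)%:E * nonlocal_seminorm p s f)%E.
Proof.
move=> q a0 s0 sD mg intf gf lip dim_g; rewrite -Lnorm_abse.
have mng : measurable_fun setT (fun x => `|g x|) by exact: measurableT_comp.
have intg : (\int[mu]_x `|g x|%:E < +oo)%E.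
  by apply: le_lt_trans intf; apply: ge0_le_integral_nomeas => x _; rewrite lee_fin.
apply: le_trans (nonlocal_embedding a0 s0 sD mng (fun=> normr_ge0 _) dim_g intg) _.
apply: lee_wpmul2l; first by rewrite lee_fin ltW// embedding_const_gt0.
exact: le_nonlocal_seminorm lip.
Qed.

End nonlocal_seminorm.

(** * Kernels with different dimensions at zero and at infinity *)

Definition dim_profile (R : realType) (D0 Dinf t : R) : R :=
  Num.min (t `^ (D0 / 2)) (t `^ (Dinf / 2)).

Section two_dimensions.
Context (d : measure_display) (T : measurableType d) (R : realType).
Variable mu : {sigma_finite_measure set T -> \bar R}.
Variables (p : R -> T -> T -> R) (b : R -> R) (a D0 Dinf s : R).
Hypothesis kernel_p : bounded_markov_kernel mu p b.
Hypotheses (a_gt0 : 0 < a) (s_gt0 : 0 < s) (s_Dinf : 2 * s < Dinf)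
  (Dinf_D0 : Dinf < D0).
Hypothesis b_le : forall t : R, 0 < t ->
  b t * dim_profile D0 Dinf t <= a / 2.
Implicit Types (f g : T -> R) (t l r : R) (E : set T).

Let Dinf_gt0 : 0 < Dinf.
Proof. by move: s_gt0 s_Dinf; lra. Qed.

Let s_D0 : 2 * s < D0.
Proof. exact: lt_trans s_Dinf Dinf_D0. Qed.

Lemma le_half_of_profile r t : 0 < t -> 0 <= r ->
  a * r <= dim_profile D0 Dinf t -> b t * r <= 2^-1.
Proof.
move=> t0 r0 ar; have [b0|b0] := leP (b t) 0.
  by apply: (le_trans (mulr_le0_ge0 b0 r0)).
rewrite -(ler_pM2l a_gt0) mulrCA; apply: le_trans (b_le t0).
by rewrite ler_pM2l.
Qed.

Let small_le_profile r t : 0 < t -> r <= 1 -> r <= t `^ (D0 / 2) ->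
  r <= dim_profile D0 Dinf t.
Proof.
move=> t0 r1 rt; rewrite /dim_profile le_min rt/=; have [t1|t1] := leP t 1.
  by apply: le_trans rt _; apply: ger_powR; rewrite ?t0// ler_pM2r// ltW.
by apply: le_trans r1 _; rewrite -[leLHS](powRr0 t) ler_powR ?divr_ge0 ?ltW.
Qed.

Let large_le_profile r t : 0 < t -> 1 < r -> r <= t `^ (Dinf / 2) ->
  r <= dim_profile D0 Dinf t.
Proof.
move=> t0 r1 rt; rewrite /dim_profile le_min rt andbT; apply: (le_trans rt).
apply: ler_powR; last by rewrite ler_pM2r// ltW.
rewrite leNgt; apply/negP => t1.
have : 1 < t `^ (Dinf / 2) by exact: lt_le_trans rt.
by rewrite ltNge -[leRHS](powRr0 t) ger_powR ?t0 ?divr_ge0 ?ltW.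
Qed.

Lemma superlevel_dim_small g :
  (forall l, 0 < l -> (mu (superlevel g l) <= (a^-1)%:E)%E) ->
  superlevel_dim mu b a D0 g.
Proof.
move=> small l t l0 t0; have := small l l0.
have : (0 <= mu (superlevel g l))%E by exact: measure_ge0.
case: (mu _) => [r| |]//; rewrite -EFinM !lee_fin => r0 ra art.
apply: le_half_of_profile => //; apply: small_le_profile => //.
by rewrite mulrC -ler_pdivlMr// div1r.
Qed.

Lemma superlevel_dim_large g :
  (forall l, 0 < l ->
     mu (superlevel g l) = 0%E \/ ((a^-1)%:E < mu (superlevel g l))%E) ->
  superlevel_dim mu b a Dinf g.
Proof.
move=> large l t l0 t0; have := large l l0.
have : (0 <= mu (superlevel g l))%E by exact: measure_ge0.
case: (mu _) => [r| |]//; last by rewrite gt0_muley ?lte_fin// leye_eq.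
move=> r0 [->|ra]; first by rewrite !mule0 lee_fin.
move: r0 ra; rewrite -!EFinM lte_fin !lee_fin => r0 ra art.
apply: le_half_of_profile => //; apply: large_le_profile => //.
by rewrite mulrC -ltr_pdivrMr// div1r.
Qed.

Let q0 := sobolev_exponent D0 s.
Let qinf := sobolev_exponent Dinf s.
Let C0 := embedding_const a D0 s.
Let Cinf := embedding_const a Dinf s.

(* [f] is cut at the level where the measure of its superlevel sets crosses
   [a^-1]: the part above the level only sees [D0], the part below only [Dinf]. *)
Lemma nonlocal_sum_embedding f :
  measurable_fun setT f -> (\int[mu]_x `|f x|%:E < +oo)%E ->
  exists f0 finf : T -> R,
    [/\ measurable_fun setT f0, measurable_fun setT finf, f = f0 \+ finf,
     ('N[mu]_(q0%:E)[EFin \o f0] <= C0%:E * nonlocal_seminorm mu p s f)%E &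
     ('N[mu]_(qinf%:E)[EFin \o finf] <= Cinf%:E * nonlocal_seminorm mu p s f)%E].
Proof.
move=> mf intf; have mnf : measurable_fun setT (fun x => `|f x|).
  exact: measurableT_comp.
have ainv0 : 0 < a^-1 by rewrite invr_gt0.
have [c [c0 above below]] := crossing_level mnf (fun x => normr_ge0 _) intf ainv0.
pose finf x := clamp c (f x); pose f0 x := f x - finf x.
have mfinf : measurable_fun setT finf.
  by apply: measurable_maxr => //; exact: measurable_minr.
have mf0 : measurable_fun setT f0 by exact: measurable_funB.
have nf0 : (fun x => `|f0 x|) = (fun x => `|f x| - Num.min `|f x| c).
  by apply/funext => x; exact: normr_sub_clamp.
have nfinf : (fun x => `|finf x|) = (fun x => Num.min `|f x| c).
  by apply/funext => x; exact: normr_clamp.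
exists f0, finf; split => //.
- by apply/funext => x /=; rewrite subrK.
- have embed := nonlocal_embedding_contraction kernel_p a_gt0 s_gt0 s_D0 mf0 intf.
  apply: embed => [x|x y|].
  + by rewrite [`|f0 x|]normr_sub_clamp// lerBlDr lerDl le_min normr_ge0.
  + rewrite [`|f0 x|]normr_sub_clamp// [`|f0 y|]normr_sub_clamp//.
    exact: le_trans (sub_min_lipschitz _ _ _) (ler_dist_dist _ _).
  + rewrite nf0; apply: superlevel_dim_small => l l0.
    by rewrite superlevel_sub_min ?(ltW l0)// above// ltrDr.
- have embed :=
    nonlocal_embedding_contraction kernel_p a_gt0 s_gt0 s_Dinf mfinf intf.
  apply: embed => [x|x y|].
  + by rewrite [`|finf x|]normr_clamp// ge_min lexx.
  + rewrite [`|finf x|]normr_clamp// [`|finf y|]normr_clamp//.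
    exact: le_trans (min_lipschitz _ _ _) (ler_dist_dist _ _).
  + rewrite nfinf; apply: superlevel_dim_large => l l0; rewrite superlevel_min.
    by case: ifP => lc; [right; exact/below/lc/ltW|left; rewrite measure0].
Qed.

Lemma nonlocal_isoperimetry E : measurable E -> (mu E < +oo)%E ->
  (Order.min (mu E `^ q0^-1) (mu E `^ qinf^-1) <=
   (C0 + Cinf)%:E * nonlocal_seminorm mu p s \1_E)%E.
Proof.
move=> mE Efin; have m1 : measurable_fun setT (\1_E : T -> R).
  exact: measurable_indic.
have int1 : (\int[mu]_x (\1_E x)%:E < +oo)%E by rewrite integral_indic// setIT.
have S0 := nonlocal_seminorm_ge0 kernel_p s \1_E.
have C0_gt0 : 0 < C0 by exact: embedding_const_gt0.
have Cinf_gt0 : 0 < Cinf by exact: embedding_const_gt0.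
have embed D : 2 * s < D -> superlevel_dim mu b a D \1_E ->
    (mu E `^ (sobolev_exponent D s)^-1 <=
     (embedding_const a D s)%:E * nonlocal_seminorm mu p s \1_E)%E.
  move=> sD dim_E; rewrite -Lnorm_indic ?sobolev_exponent_gt0//.
  exact: (nonlocal_embedding kernel_p).
rewrite ge_min; have [small|large] := leP (mu E) (a^-1)%:E.
  apply/orP; left; apply: le_trans (embed D0 s_D0 _) _.
    apply: superlevel_dim_small => l l0; rewrite superlevel_indic ?(ltW l0)//.
    case: ifP => _; first exact: small.
    by rewrite measure0 lee_fin invr_ge0 ltW.
  by rewrite lee_wpmul2r// lee_fin -/C0 lerDl (ltW Cinf_gt0).
apply/orP; right; apply: le_trans (embed Dinf s_Dinf _) _.
  apply: superlevel_dim_large => l l0; rewrite superlevel_indic ?(ltW l0)//.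
  by case: ifP => _; [right|left; rewrite measure0].
by rewrite lee_wpmul2r// lee_fin -/Cinf lerDr (ltW C0_gt0).
Qed.

End two_dimensions.

(** * Positive definite matrices and Gaussian integrals *)

Section positive_definite.
Context (R : realType).
Implicit Types (n : nat) (a x : R).

Lemma dotvE n (u v : 'cV[R]_n) : dotv u v = (u^T *m v) 0 0.
Proof. by rewrite mxE; apply: eq_bigr => i _; rewrite mxE. Qed.

Lemma dotvC n (u v : 'cV[R]_n) : dotv u v = dotv v u.
Proof. by apply: eq_bigr => i _; rewrite mulrC. Qed.

Lemma dotv0l n (v : 'cV[R]_n) : dotv 0 v = 0.
Proof. by rewrite dotvE trmx0 mul0mx mxE. Qed.

Lemma dotvDl n (u v w : 'cV[R]_n) : dotv (u + v) w = dotv u w + dotv v w.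
Proof. by rewrite !dotvE linearD/= mulmxDl mxE. Qed.

Lemma dotvZl n (c : R) (u w : 'cV[R]_n) : dotv (c *: u) w = c * dotv u w.
Proof. by rewrite !dotvE linearZ/= -scalemxAl mxE. Qed.

Lemma dotvBl n (u v w : 'cV[R]_n) : dotv (u - v) w = dotv u w - dotv v w.
Proof. by rewrite -scaleN1r dotvDl dotvZl mulN1r. Qed.

Lemma dotv_mulmx n (A : 'M[R]_n) (u v : 'cV[R]_n) :
  dotv (A *m u) v = dotv u (A^T *m v).
Proof. by rewrite !dotvE trmx_mul mulmxA. Qed.

Lemma dotv_col_mx m n (u1 v1 : 'cV[R]_m) (u2 v2 : 'cV[R]_n) :
  dotv (col_mx u1 u2) (col_mx v1 v2) = dotv u1 v1 + dotv u2 v2.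
Proof. by rewrite !dotvE tr_col_mx mul_row_col mxE. Qed.

Lemma trmx_mul_cV n (u v : 'cV[R]_n) : u^T *m v = (dotv u v)%:M.
Proof. by rewrite [LHS]mx11_scalar dotvE. Qed.

Lemma dotv_scalar_mx x y : dotv x%:M y%:M = x * y :> R.
Proof. by rewrite dotvE tr_scalar_mx -scalar_mxM mxE mulr1n. Qed.

Definition spdmx n (A : 'M[R]_n) : Prop := A^T = A /\ pdmx A.

Lemma spdmx_diag_gt0 n (A : 'M[R]_n) i : spdmx A -> 0 < A i i.
Proof.
case=> _ /(_ (delta_mx i 0)); rewrite -colE dotvC dotvE trmx_delta -rowE !mxE.
by apply; apply/eqP => /matrixP/(_ i 0)/eqP; rewrite !mxE !eqxx oner_eq0.
Qed.

Lemma spdmxZ n a (A : 'M[R]_n) : 0 < a -> spdmx A -> spdmx (a *: A).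
Proof.
move=> a0 [sA pA]; split; first by rewrite linearZ/= sA.
by move=> u u0; rewrite -scalemxAl dotvZl mulr_gt0// pA.
Qed.

Lemma spdmxD n (A C : 'M[R]_n) : spdmx A -> spdmx C -> spdmx (A + C).
Proof.
move=> [sA pA] [sC pC]; split; first by rewrite linearD/= sA sC.
by move=> u u0; rewrite mulmxDl dotvDl addr_gt0 ?pA ?pC.
Qed.

Lemma spdmx_psdmx n (A : 'M[R]_n) : spdmx A -> psdmx A.
Proof.
move=> [_ pA] u; have [->|u0] := eqVneq u 0; last exact/ltW/pA.
by rewrite mulmx0 dotv0l.
Qed.

Lemma spdmx_conj n (P A : 'M[R]_n) : P \in unitmx -> spdmx A ->
  spdmx (P *m A *m P^T).
Proof.
move=> uP [sA pA]; split; first by rewrite !trmx_mul trmxK sA mulmxA.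
move=> u u0; rewrite -!mulmxA dotv_mulmx; apply: pA.
have uPT : P^T \in unitmx by rewrite unitmx_tr.
by apply: contraNneq u0 => PTu; rewrite -(mulKmx uPT u) PTu mulmx0.
Qed.

Section schur_complement.
Variables (n : nat) (a : R) (b : 'cV[R]_n) (C : 'M[R]_n).
Let block : 'M[R]_(1 + n) := block_mx a%:M b^T b C.

Definition schur_complement : 'M[R]_n := C - a^-1 *: (b *m b^T).

Lemma dotv_quad_block x (u : 'cV[R]_n) : a != 0 ->
  dotv (block *m col_mx x%:M u) (col_mx x%:M u) =
  a * (x + dotv b u / a) ^+ 2 + dotv (schur_complement *m u) u.
Proof.
move=> a0; rewrite mul_block_col dotv_col_mx trmx_mul_cV -scalar_mxM -raddfD/=.
rewrite dotv_scalar_mx mul_mx_scalar dotvDl dotvZl mulmxBl dotvBl -scalemxAl.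
by rewrite dotvZl -mulmxA trmx_mul_cV mul_mx_scalar dotvZl; field.
Qed.

Lemma det_block_schur : a != 0 -> \det block = a * \det schur_complement.
Proof.
move=> a0.
have -> : block = block_mx 1%:M 0 (a^-1 *: b) 1%:M *m
    block_mx a%:M b^T 0 schur_complement.
  rewrite mulmx_block !mul1mx !mul0mx ?mulmx0 !addr0 mul_mx_scalar scalerA.
  by rewrite divff// scale1r -scalemxAl addrC subrK.
by rewrite det_mulmx det_lblock det_ublock !det1 !mul1r det_scalar1.
Qed.

Lemma spdmx_schur_complement : spdmx block -> spdmx schur_complement.
Proof.
move=> spd_block; have a0 : a != 0.
  have := spdmx_diag_gt0 (lshift n 0) spd_block.
  by rewrite block_mxEul mxE mulr1n => /lt0r_neq0.
case: spd_block => + pd_block; rewrite tr_block_mx trmxK => /eq_block_mx[_ _ _ sC].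
split; first by rewrite linearB/= linearZ/= trmx_mul trmxK sC.
move=> u u0; have := pd_block (col_mx (- (dotv b u / a))%:M u).
rewrite dotv_quad_block// addNr expr0n mulr0 add0r; apply.
by rewrite col_mx_eq0 negb_and u0 orbT.
Qed.

End schur_complement.

Lemma spdmx_ind (P : forall n, 'M[R]_n -> Prop) :
  (forall A : 'M[R]_0, P 0%N A) ->
  (forall n a (b : 'cV[R]_n) C, 0 < a -> spdmx (schur_complement a b C) ->
     P n (schur_complement a b C) -> P (1 + n)%N (block_mx a%:M b^T b C)) ->
  forall n (A : 'M[R]_n), spdmx A -> P n A.
Proof.
move=> P0 PS; elim=> [|n IH] A spdA; first exact: P0.
change (P (1 + n)%N (A : 'M[R]_(1 + n))).
pose a := A ord0 ord0; pose A' : 'M[R]_(1 + n) := A.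
have AE : A' = block_mx a%:M (dlsubmx A')^T (dlsubmx A') (drsubmx A').
  rewrite -[LHS]submxK; congr block_mx; last by rewrite trmx_dlsub /A' spdA.1.
  by rewrite [LHS]mx11_scalar !mxE; congr (A _ _)%:M; apply/val_inj.
have spdS : spdmx (schur_complement a (dlsubmx A') (drsubmx A')).
  by apply: spdmx_schur_complement; rewrite -AE.
rewrite -/A' AE; apply: PS => //; first exact: spdmx_diag_gt0.
exact: IH.
Qed.

Lemma spdmx_det_gt0 n (A : 'M[R]_n) : spdmx A -> 0 < \det A.
Proof.
move: n A; apply: (spdmx_ind (P := fun n A => 0 < \det A)) => [A|n a b C a0 _ detS].
  by rewrite det_mx00.
by rewrite det_block_schur ?gt_eqF// mulr_gt0.
Qed.

Lemma spdmx_unit n (A : 'M[R]_n) : spdmx A -> A \in unitmx.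
Proof. by move=> /spdmx_det_gt0 detA; rewrite unitmxE unitfE gt_eqF. Qed.

Lemma spdmx_inv n (A : 'M[R]_n) : spdmx A -> spdmx (invmx A).
Proof.
move=> spdA; have uA := spdmx_unit spdA.
have uV : invmx A \in unitmx by rewrite unitmx_inv.
have := spdmx_conj uV spdA; rewrite mulVmx// mul1mx trmx_inv.
by rewrite spdA.1.
Qed.

End positive_definite.

Section gaussian.
Context (R : realType).
Local Notation M := (measurableTypeR R).
Implicit Types (n : nat).

Definition gaussian n (A : 'M[R]_n) (v : 'cV[R]_n) : R := expR (- dotv (A *m v) v).

Lemma gaussian_ge0 n (A : 'M[R]_n) v : 0 <= gaussian A v.
Proof. exact: expR_ge0. Qed.

Lemma measurable_quadratic n (A : 'M[R]_n) (w : 'cV[R]_n) :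
  measurable_fun [set: n.-tuple M]
    (fun x : n.-tuple M => dotv (A *m (colv x - w)) (colv x - w)).
Proof.
have mcoord i : measurable_fun [set: n.-tuple M]
    (fun x : n.-tuple M => (colv x - w) i 0).
  under eq_fun do rewrite !mxE.
  by apply: measurable_funB => //; exact: measurable_tnth.
apply: measurable_sum => i; apply: measurable_funM => //.
under eq_fun do rewrite mxE.
by apply: measurable_sum => j; exact: measurable_funM.
Qed.

Lemma measurable_gaussian n (A : 'M[R]_n) (w : 'cV[R]_n) :
  measurable_fun [set: n.-tuple M]
    (fun x : n.-tuple M => (gaussian A (colv x - w))%:E).
Proof.
apply/measurable_EFinP; apply: measurableT_comp => //; apply: measurable_funN.
exact: measurable_quadratic.
Qed.

Lemma integral_expR_quadratic (a c : R) : 0 < a ->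
  (\int[lebesgue_measure]_x (expR (- (a * (x + c) ^+ 2)))%:E =
   (Num.sqrt pi / Num.sqrt a)%:E)%E.
Proof.
move=> a0; pose sg := Num.sqrt ((2 * a)^-1).
have sg2 : sg ^+ 2 = (2 * a)^-1 by rewrite sqr_sqrtr// invr_ge0 mulr_ge0 ?ltW.
have sg0 : sg != 0 by rewrite gt_eqF// sqrtr_gt0 invr_gt0 mulr_gt0.
have peak : normal_peak sg = (Num.sqrt (pi / a))^-1.
  by rewrite /normal_peak sg2; congr (Num.sqrt _)^-1; field; rewrite gt_eqF.
have pia0 : 0 < Num.sqrt (pi / a) by rewrite sqrtr_gt0 divr_gt0// pi_gt0.
transitivity (\int[lebesgue_measure]_x
    ((Num.sqrt (pi / a))%:E * (normal_pdf (- c) sg x)%:E))%E.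
  apply: eq_integral => x _; rewrite normal_pdfE// -EFinM; congr EFin.
  rewrite peak mulVKf ?gt_eqF// /normal_fun sg2 opprK; congr expR.
  by field; rewrite gt_eqF.
rewrite ge0_integralZl_EFin ?(ltW pia0)//; last 2 first.
- by move=> x _; rewrite lee_fin normal_pdf_ge0.
- by apply/measurable_EFinP; exact: measurable_normal_pdf.
by rewrite integral_normal_pdf mule1 sqrtrM ?pi_ge0// sqrtrV ?(ltW a0).
Qed.

Lemma colv_consT n (x : R) (t : n.-tuple M) :
  colv (consT (x, t)) = col_mx x%:M (colv t) :> 'cV[R]_(1 + n).
Proof.
apply/matrixP => i j; rewrite !mxE; case: splitP => k ik; rewrite !mxE.
  rewrite !ord1 mulr1n; congr (_ : R).
  by rewrite (_ : i = ord0)//; apply/val_inj; rewrite /= ik ord1.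
by rewrite (_ : i = lift ord0 k) ?tnthS//; apply/val_inj; rewrite /= ik.
Qed.

Lemma ge0_integral_borel_lebesgueS n (F : n.+1.-tuple M -> \bar R) :
  measurable_fun setT F -> (forall x, 0 <= F x)%E ->
  (\int[borel_lebesgue R n.+1]_x F x =
   \int[borel_lebesgue R n]_t \int[lebesgue_measure]_x F (consT (x, t)))%E.
Proof.
move=> mF F0; have mcons := @measurable_consT R n.
rewrite /= /cons_measure ge0_integral_pushforward// preimage_setT.
rewrite fubini_tonelli2//; first exact: measurableT_comp mF mcons.
by move=> z; exact: F0.
Qed.

Lemma gaussian_block n (a x : R) (b u : 'cV[R]_n) C : a != 0 ->
  gaussian (block_mx a%:M b^T b C) (col_mx x%:M u) =
  expR (- (a * (x + dotv b u / a) ^+ 2)) * gaussian (schur_complement a b C) u.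
Proof. by move=> a0; rewrite /gaussian dotv_quad_block// opprD expRD. Qed.

Lemma integral_gaussian n (A : 'M[R]_n) (w : 'cV[R]_n) : spdmx A ->
  (\int[borel_lebesgue R n]_x (gaussian A (colv x - w))%:E =
   (Num.sqrt (pi ^+ n) / Num.sqrt (\det A))%:E)%E.
Proof.
move=> spdA; move: n A spdA w.
apply: (spdmx_ind (P := fun n A => forall w, _)) => [A w|n a b C a0 spdS IH w].
  rewrite det_mx00 expr0 sqrtr1 divr1 /= integral_dirac ?diracT ?mul1e//.
    by rewrite /gaussian /dotv big_ord0 oppr0 expR0.
  exact: measurable_gaussian.
rewrite ge0_integral_borel_lebesgueS; last 2 first.
- exact: measurable_gaussian.
- by move=> x; rewrite lee_fin gaussian_ge0.
pose w0 := w 0 0; pose w1 : 'cV[R]_n := dsubmx w.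
have wE : w = col_mx w0%:M w1.
  rewrite -[LHS]vsubmxK; congr col_mx; rewrite [LHS]mx11_scalar !mxE.
  by congr (w _ _)%:M; apply/val_inj.
transitivity (\int[borel_lebesgue R n]_t ((Num.sqrt pi / Num.sqrt a)%:E *
    (gaussian (schur_complement a b C) (colv t - w1))%:E))%E.
  apply: eq_integral => t _; pose u := colv t - w1.
  rewrite -(integral_expR_quadratic (dotv b u / a - w0) a0).
  rewrite -ge0_integralZr//; last 2 first.
  - apply/measurable_EFinP/measurableT_comp => //; apply: measurable_funN.
    by apply: measurable_funM => //; apply: measurable_funX; exact: measurable_funD.
  - by rewrite lee_fin gaussian_ge0.
  apply: eq_integral => x _; rewrite -EFinM; congr EFin.
  rewrite colv_consT wE opp_col_mx add_col_mx -raddfB gaussian_block ?gt_eqF//.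
  by rewrite /= addrA addrAC.
rewrite ge0_integralZl_EFin ?divr_ge0 ?sqrtr_ge0//; last 2 first.
- by move=> x _; rewrite lee_fin gaussian_ge0.
- exact: measurable_gaussian.
rewrite IH -EFinM det_block_schur ?gt_eqF// exprS !sqrtrM ?pi_ge0 ?(ltW a0)//.
by rewrite mulrACA -invfM.
Qed.

End gaussian.

Section determinant_inequalities.
Context (R : realType) (n : nat).
Implicit Types A C D : 'M[R]_n.

Let sqrt_pi_gt0 : 0 < Num.sqrt (pi ^+ n) :> R.
Proof. by rewrite sqrtr_gt0 exprn_gt0// pi_gt0. Qed.

Lemma det_spdmx_le A D : spdmx A -> spdmx D -> psdmx (D - A) ->
  \det A <= \det D.
Proof.
move=> spdA spdD psd_DA.
have : (\int[borel_lebesgue R n]_x (gaussian D (colv x - 0))%:E <=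
        \int[borel_lebesgue R n]_x (gaussian A (colv x - 0))%:E)%E.
  apply: ge0_le_integral_nomeas => x _; rewrite lee_fin ?gaussian_ge0//.
  by rewrite ler_expR lerN2 -subr_ge0 -dotvBl -mulmxBl.
have dA := spdmx_det_gt0 spdA; have dD := spdmx_det_gt0 spdD.
rewrite !integral_gaussian// lee_fin ler_pM2l// lef_pV2 ?posrE ?sqrtr_gt0//.
by rewrite ler_sqrt// ltW.
Qed.

Lemma convex_invr_sqrt_det (t : R) A C : 0 <= t <= 1 -> spdmx A -> spdmx C ->
  spdmx (t *: A + (1 - t) *: C) ->
  (Num.sqrt (\det (t *: A + (1 - t) *: C)))^-1 <=
  t * (Num.sqrt (\det A))^-1 + (1 - t) * (Num.sqrt (\det C))^-1.
Proof.
move=> /andP[t0 t1] spdA spdC; set D := _ + _ => spdD.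
have t1' : 0 <= 1 - t by rewrite subr_ge0.
have gaussian_conv (v : 'cV[R]_n) :
    gaussian D v <= t * gaussian A v + (1 - t) * gaussian C v.
  have := convex_expR (Itv01 t0 t1) (- dotv (A *m v) v) (- dotv (C *m v) v).
  rewrite !convRE -/(gaussian A v) -/(gaussian C v); apply: le_trans.
  by rewrite ler_expR /D mulmxDl dotvDl -!scalemxAl !dotvZl !mulrN opprD.
have : (\int[borel_lebesgue R n]_x (gaussian D (colv x - 0))%:E <=
   \int[borel_lebesgue R n]_x (t%:E * (gaussian A (colv x - 0))%:E +
                               (1 - t)%:E * (gaussian C (colv x - 0))%:E))%E.
  apply: ge0_le_integral_nomeas => x _; first by rewrite lee_fin gaussian_ge0.
  by rewrite -!EFinM -EFinD lee_fin gaussian_conv.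
rewrite ge0_integralD//; last 4 first.
- by move=> x _; rewrite -EFinM lee_fin mulr_ge0 ?gaussian_ge0.
- by apply: measurable_funeM; exact: measurable_gaussian.
- by move=> x _; rewrite -EFinM lee_fin mulr_ge0 ?gaussian_ge0.
- by apply: measurable_funeM; exact: measurable_gaussian.
rewrite !ge0_integralZl_EFin//; try exact: measurable_gaussian;
  try by move=> x _; rewrite lee_fin gaussian_ge0.
rewrite !integral_gaussian// -!EFinM -EFinD lee_fin.
by rewrite !(mulrCA _ (Num.sqrt (pi ^+ n))) -mulrDr ler_pM2l.
Qed.

Lemma det_spdmxD_ge A C : spdmx A -> spdmx C -> \det A <= \det C ->
  2 ^+ n * \det A <= \det (A + C).
Proof.
move=> spdA spdC dAC; have dA := spdmx_det_gt0 spdA; have dC := spdmx_det_gt0 spdC.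
have halfC : 1 - 2^-1 = 2^-1 :> R by field.
have spdAC := spdmxD spdA spdC.
have spd_half : spdmx (2^-1 *: (A + C)) by exact: spdmxZ.
have half01 : 0 <= (2^-1 : R) <= 1 by apply/andP; split; lra.
have := convex_invr_sqrt_det half01 spdA spdC.
rewrite halfC -scalerDr => /(_ spd_half).
have : (Num.sqrt (\det C))^-1 <= (Num.sqrt (\det A))^-1.
  by rewrite lef_pV2 ?posrE ?sqrtr_gt0// ler_sqrt// ltW.
move=> invC_le invD_le.
have : (Num.sqrt (\det (2^-1 *: (A + C))))^-1 <= (Num.sqrt (\det A))^-1.
  lra.
have d_half := spdmx_det_gt0 spd_half.
rewrite lef_pV2 ?posrE ?sqrtr_gt0// ler_sqrt ?(ltW d_half)//.
by rewrite detZ exprVn mulrC ler_pdivlMr ?exprn_gt0// mulrC.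
Qed.

End determinant_inequalities.

(** * Matrix calculus *)

Section matrix_calculus.
Context (R : realType).
Implicit Types (V : normedModType R).

Lemma cvg_bigsum (T I : Type) (F : set_system T) (r : seq I) (f : I -> T -> R)
    (l : I -> R) {FF : Filter F} :
  (forall i, f i x @[x --> F] --> l i) ->
  \sum_(i <- r) f i x @[x --> F] --> \sum_(i <- r) l i.
Proof.
move=> fl; have -> : (fun x => \sum_(i <- r) f i x) = \sum_(i <- r) f i.
  by apply/funext => x; rewrite fct_sumE.
by elim/big_ind2 : _ => // [|g a k b ga kb]; [exact: cvg_cst|exact: cvgD].
Qed.

Lemma cvg_mx (T : Type) (F : set_system T) m n (f : T -> 'M[R]_(m, n))
    (A : 'M[R]_(m, n)) {FF : Filter F} :
  (forall i j, f x i j @[x --> F] --> A i j) -> f @ F --> A.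
Proof.
move=> fA; apply/cvg_ballP => e e0.
have : \forall x \near F, forall i j, ball (A i j) e (f x i j).
  apply: filter_forall => i; apply: filter_forall => j.
  by have /cvg_ballP := fA i j; exact.
by apply: filterS.
Qed.

Lemma cvg_mx_entry (T : Type) (F : set_system T) m n (f : T -> 'M[R]_(m, n))
    (A : 'M[R]_(m, n)) i j {FF : Filter F} :
  f @ F --> A -> f x i j @[x --> F] --> A i j.
Proof. by move=> fA; exact: cvg_comp fA (@coord_continuous _ _ _ i j A). Qed.

Lemma cvg_mulmx (T : Type) (F : set_system T) m n p (f : T -> 'M[R]_(m, n))
    (g : T -> 'M[R]_(n, p)) (A : 'M[R]_(m, n)) (C : 'M[R]_(n, p)) {FF : Filter F} :
  f @ F --> A -> g @ F --> C -> f x *m g x @[x --> F] --> A *m C.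
Proof.
move=> fA gC; apply: cvg_mx => i j.
under eq_fun do rewrite mxE; rewrite mxE.
by apply: cvg_bigsum => k; apply: cvgM; exact: cvg_mx_entry.
Qed.

Lemma cvg_trmx (T : Type) (F : set_system T) m n (f : T -> 'M[R]_(m, n))
    (A : 'M[R]_(m, n)) {FF : Filter F} :
  f @ F --> A -> (f x)^T @[x --> F] --> A^T.
Proof.
move=> fA; apply: cvg_mx => i j; under eq_fun do rewrite mxE.
by rewrite mxE; exact: cvg_mx_entry.
Qed.

Lemma is_derive_mxP V m n (M : V -> 'M[R]_(m, n)) x v dM :
  is_derive x v M dM <->
  forall i j, is_derive x v (fun y => M y i j) (dM i j).
Proof.
split=> [[dx <-] i j|dM_ij].
  rewrite derive_mx// mxE; apply: derivableP.
  by move: i j; apply/derivable_mxP.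
have dx : derivable M x v by apply/derivable_mxP => i j; have [] := dM_ij i j.
split=> //; rewrite derive_mx//; apply/matrixP => i j; rewrite mxE.
by have [_ ->] := dM_ij i j.
Qed.

Lemma is_derive_bigsum V (I : Type) (r : seq I) (f : I -> V -> R) (df : I -> R)
    x v : (forall i, is_derive x v (f i) (df i)) ->
  is_derive x v (fun y => \sum_(i <- r) f i y) (\sum_(i <- r) df i).
Proof.
move=> dfx; have -> : (fun y => \sum_(i <- r) f i y) = \sum_(i <- r) f i.
  by apply/funext => y; rewrite fct_sumE.
by elim/big_ind2 : _ => // [|*]; [exact: is_derive_cst|exact: is_deriveD].
Qed.

Lemma is_derive_mulmx V m n p (F : V -> 'M[R]_(m, n)) (G : V -> 'M[R]_(n, p))
    x v dF dG : is_derive x v F dF -> is_derive x v G dG ->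
  is_derive x v (fun y => F y *m G y) (dF *m G x + F x *m dG).
Proof.
move=> /is_derive_mxP dFx /is_derive_mxP dGx; apply/is_derive_mxP => i j.
under eq_fun do rewrite mxE.
rewrite [X in is_derive _ _ _ X]mxE !mxE -big_split/=.
apply: is_derive_bigsum => k.
apply: is_derive_eq (is_deriveM (dFx i k) (dGx k j)) _.
by rewrite addrC [G x k j *: _]mulrC.
Qed.

Lemma is_derive_prod V (I : finType) (f : I -> V -> R) (df : I -> R) x v :
  (forall i, is_derive x v (f i) (df i)) ->
  is_derive x v (fun y => \prod_i f i y)
    (\sum_i df i * \prod_(j | j != i) f j x).
Proof.
move=> dfx.
suff prod_seq (r : seq I) : uniq r -> is_derive x v (fun y => \prod_(i <- r) f i y)
    (\sum_(i <- r) df i * \prod_(j <- r | j != i) f j x).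
  exact: prod_seq (index_enum_uniq I).
elim: r => [_|k r IH /= /andP[kr /IH dr]].
  by under eq_fun do rewrite big_nil; rewrite big_nil; exact: is_derive_cst.
under eq_fun do rewrite big_cons.
apply: is_derive_eq (is_deriveM (dfx k) dr) _.
rewrite !big_cons eqxx/= addrC /GRing.scale/= mulrC; congr (_ + _).
  congr (_ * _); rewrite [RHS]big_seq_cond [LHS]big_seq; apply: eq_bigl => j.
  by case: (boolP (j \in r)) => //= jr; apply/esym; apply: contraNneq kr => <-.
rewrite mulr_sumr; apply: eq_big_seq => i ir; rewrite big_cons.
by rewrite ifT 1?mulrCA//; apply: contraNneq kr => ->.
Qed.

Lemma is_derive_det V n (A : V -> 'M[R]_n) x v dA : is_derive x v A dA ->
  is_derive x v (fun y => \det (A y)) (\tr (\adj (A x) *m dA)).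
Proof.
move=> /is_derive_mxP dAx.
pose replace_row i := \matrix_(k, l) (if k == i then dA k l else A x k l).
have -> : \tr (\adj (A x) *m dA) = \sum_i \det (replace_row i).
  rewrite /mxtrace; under eq_bigr do rewrite mxE.
  rewrite exchange_big; apply: eq_bigr => i _; rewrite (expand_det_row _ i).
  apply: eq_bigr => j _; rewrite !mxE eqxx mulrC; congr (_ * (_ * \det _)).
  by apply/matrixP => k l; rewrite !mxE eq_sym (negbTE (neq_lift _ _)).
rewrite exchange_big/=.
apply: is_derive_bigsum => s.
have d_prod := is_derive_prod (fun i => dAx i (s i)).
apply: is_derive_eq (is_deriveZ ((-1) ^+ s) d_prod) _.
rewrite /GRing.scale/= mulr_sumr; apply: eq_bigr => i _; congr (_ * _).
rewrite [RHS](bigD1 i)//= !mxE eqxx; congr (_ * _).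
by apply: eq_bigr => j ji; rewrite mxE (negbTE ji).
Qed.

Lemma mx_norm_entry_le m n (P : 'M[R]_(m, n)) i j : `|P i j| <= `|P|.
Proof.
rewrite [leRHS]/Num.Def.normr/= mx_normrE.
exact: (le_bigmax _ (fun ij => `|P ij.1 ij.2|) (i, j)).
Qed.

Lemma mx_norm_le m n (P : 'M[R]_(m, n)) (c : R) : 0 <= c ->
  (forall i j, `|P i j| <= c) -> `|P| <= c.
Proof.
move=> c0 Pc; rewrite [leLHS]/Num.Def.normr/= mx_normrE.
by apply: bigmax_le => // -[i j] _; exact: Pc.
Qed.

Lemma mx_norm_mulmx_le m n p (P : 'M[R]_(m, n)) (Q : 'M[R]_(n, p)) :
  `|P *m Q| <= `|P| * (n%:R * `|Q|).
Proof.
apply: mx_norm_le => [|i j]; first by rewrite !mulr_ge0.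
rewrite mxE; apply: le_trans (ler_norm_sum _ _ _) _.
apply: (@le_trans _ _ (\sum_(k < n) `|P| * `|Q|)).
  by apply: ler_sum => k _; rewrite normrM ler_pM ?mx_norm_entry_le.
by rewrite sumr_const card_ord -[leLHS]mulr_natl mulrCA.
Qed.

End matrix_calculus.

Section matrix_exponential.
Context (R : realType) (N : nat).
Implicit Types B P : 'M[R]_N.

Lemma mx_norm_mulmxX_le P B k : `|P *m B ^+ k| <= `|P| * (N%:R * `|B|) ^+ k.
Proof.
elim: k => [|k IH]; first by rewrite !expr0 mulmx1 mulr1.
rewrite !exprSr -[B ^+ k * B]/(B ^+ k *m B) mulmxA.
apply: le_trans (mx_norm_mulmx_le _ _) _.
by rewrite [leRHS]mulrA ler_wpM2r// mulr_ge0.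
Qed.

Lemma exprZ_mx B (t : R) k : (t *: B) ^+ k = t ^+ k *: B ^+ k.
Proof.
elim: k => [|k IH]; first by rewrite !expr0 scale1r.
by rewrite !exprS IH -[LHS]/(_ *m _) -scalemxAl -scalemxAr scalerA.
Qed.

Lemma trmxX B k : (B ^+ k)^T = B^T ^+ k.
Proof.
elim: k => [|k IH]; first by rewrite !expr0 [LHS]trmx1.
by rewrite exprSr exprS -IH [LHS]trmx_mul.
Qed.

(* The entries of [P *m expmx (t *: B)] are power series in [t]; keeping the
   factor [P] makes the family closed under differentiation. *)
Definition expmx_coef P B i j (k : nat) : R := (k`!%:R)^-1 * (P *m B ^+ k) i j.

Lemma is_cvg_expmx_coef P B i j x : cvgn (pseries (expmx_coef P B i j) x).
Proof.
apply: normed_cvg; pose b := N%:R * `|B| * `|x|.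
have b0 : 0 <= b by rewrite !mulr_ge0.
apply: (@series_le_cvg _ _ (fun k => `|P| * exp_coeff b k)) => [k|k|k|] /=.
- exact: normr_ge0.
- by rewrite mulr_ge0// exp_coeff_ge0.
- rewrite /expmx_coef exp_coeffE !normrM normfV normrX (ger0_norm (ler0n _ _)).
  rewrite [leRHS]mulrCA -mulrA ler_wpM2l ?invr_ge0//.
  rewrite /b exprMn mulrA ler_wpM2r ?exprn_ge0//.
  exact: le_trans (mx_norm_entry_le _ _ _) (mx_norm_mulmxX_le _ _ _).
- by apply: is_cvg_seriesZ; exact: is_cvg_series_exp_coeff.
Qed.

Lemma pseries_diffs_expmx_coef P B i j :
  pseries_diffs (expmx_coef P B i j) = expmx_coef (P *m B) B i j.
Proof.
apply/funext => k; rewrite /pseries_diffs /expmx_coef exprS mulmxA mulrA.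
by rewrite factS natrM invfM mulVKf.
Qed.

Lemma cvg_expmx B : series (fun k => (k`!%:R)^-1 *: B ^+ k) @ \oo --> expmx B.
Proof.
suff [L B_L] : exists L : 'M[R]_N,
    series (fun k => (k`!%:R)^-1 *: B ^+ k) @ \oo --> L.
  by rewrite /expmx (cvg_lim _ B_L)//; exact: norm_hausdorff.
exists (\matrix_(i, j) limn (pseries (expmx_coef 1%:M B i j) 1)).
apply: cvg_mx => i j; rewrite mxE.
suff -> : (fun n => series (fun k => (k`!%:R)^-1 *: B ^+ k) n i j) =
    pseries (expmx_coef 1%:M B i j) 1 by exact: is_cvg_expmx_coef.
apply/funext => n; rewrite /pseries /series/= summxE; apply: eq_bigr => k _.
by rewrite /expmx_coef mul1mx expr1n mulr1 mxE.
Qed.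

Lemma mulmx_expmxE P B (t : R) i j :
  (P *m expmx (t *: B)) i j = limn (pseries (expmx_coef P B i j) t).
Proof.
apply/esym/cvg_lim => //.
suff -> : pseries (expmx_coef P B i j) t = (fun n =>
    (P *m series (fun k => (k`!%:R)^-1 *: (t *: B) ^+ k) n) i j).
  by apply: cvg_mx_entry; apply: cvg_mulmx; [exact: cvg_cst|exact: cvg_expmx].
apply/funext => n; rewrite /pseries /series/= mulmx_sumr summxE.
apply: eq_bigr => k _.
by rewrite /expmx_coef exprZ_mx -!scalemxAr !mxE mulrA mulrAC.
Qed.

Lemma expmx0 : expmx 0 = 1%:M :> 'M[R]_N.
Proof.
apply/cvg_lim; first exact: norm_hausdorff.
apply: cvg_near_cst; near=> n; have n0 : (0 < n)%N by near: n; exact: nbhs_infty_gt.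
rewrite /series/= -(prednK n0) big_nat_recl//= big1 => [|k _].
  by rewrite fact0 invr1 scale1r expr0 addr0.
by rewrite exprS mul0r scaler0.
Unshelve. all: by end_near. Qed.

Lemma trmx_expmx B : (expmx B)^T = expmx B^T.
Proof.
apply/esym/cvg_lim; first exact: norm_hausdorff.
suff -> : series (fun k => (k`!%:R)^-1 *: B^T ^+ k) =
    (fun n => (series (fun k => (k`!%:R)^-1 *: B ^+ k) n)^T).
  by apply: cvg_trmx; exact: cvg_expmx.
apply/funext => n; rewrite /series/= [RHS]linear_sum/=; apply: eq_bigr => k _.
by rewrite [RHS]linearZ/= trmxX.
Qed.

Lemma comm_mx_expmx A B : comm_mx A B -> comm_mx A (expmx B).
Proof.
move=> AB; pose S := series (fun k => (k`!%:R)^-1 *: B ^+ k).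
have AS n : comm_mx A (S n).
  apply: comm_mx_sum => k _; rewrite /comm_mx -scalemxAr -scalemxAl.
  suff -> : comm_mx A (B ^+ k) by [].
  by elim: k => [|k IH]; rewrite ?exprS; [exact: comm_mx1|exact: comm_mxM].
have S_expmx : S @ \oo --> expmx B by exact: cvg_expmx.
have : A *m S n @[n --> \oo] --> A *m expmx B.
  by apply: cvg_mulmx => //; exact: cvg_cst.
have : A *m S n @[n --> \oo] --> expmx B *m A.
  by under eq_fun do rewrite AS; apply: cvg_mulmx => //; exact: cvg_cst.
move=> lim_r lim_l; exact: (cvg_unique (@norm_hausdorff _ _) lim_l lim_r).
Qed.

Lemma is_derive_expmx B (t : R) :
  is_derive t (1 : R) (fun u => expmx (u *: B)) (B *m expmx (t *: B)).
Proof.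
apply/is_derive_mxP => i j; rewrite mulmx_expmxE.
under eq_fun do rewrite -[expmx _]mul1mx mulmx_expmxE.
have := @pseries_snd_diffs R (expmx_coef 1%:M B i j) (`|t| + 1) t.
rewrite !pseries_diffs_expmx_coef mul1mx; apply; try exact: is_cvg_expmx_coef.
by rewrite [ltRHS]ger0_norm ?ltrDl ?addr_ge0.
Qed.

Lemma continuous_expmx B : continuous (fun t : R => expmx (t *: B)).
Proof.
move=> t; apply/differentiable_continuous/derivable1_diffP.
by have [] := is_derive_expmx B t.
Qed.

(* [expmx (t *: B) *m expmx ((u + v - t) *: B)] has zero derivative in [t]. *)
Lemma expmxDl B (u v : R) :
  expmx ((u + v) *: B) = expmx (u *: B) *m expmx (v *: B).
Proof.
pose G t := expmx ((u + v - t) *: B); pose H t := expmx (t *: B) *m G t.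
have dG t : is_derive t (1 : R) G (- (B *m G t)).
  apply/is_derive_mxP => i j.
  have d1 : is_derive t (1 : R) (fun t => u + v - t) (- 1).
    have d_sub := is_deriveB (is_derive_cst (u + v) t 1) (is_derive_id t 1).
    by apply: is_derive_eq d_sub _; rewrite sub0r.
  have /is_derive_mxP/(_ i j) dE := is_derive_expmx B (u + v - t).
  have := @is_derive1_comp R (fun t => expmx (t *: B) i j)
    (fun t => u + v - t) t _ _ dE d1.
  by rewrite mulrN1 [X in _ -> is_derive _ _ _ X]mxE.
have dH t : is_derive t (1 : R) H 0.
  apply: is_derive_eq (is_derive_mulmx (is_derive_expmx B t) (dG t)) _.
  have comm_B : B *m expmx (t *: B) = expmx (t *: B) *m B.
    by apply: comm_mx_expmx; rewrite /comm_mx -scalemxAr -scalemxAl.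
  by rewrite comm_B mulmxN !mulmxA subrr.
have H_cst : H 0 = H u.
  apply/matrixP => i j; apply: (is_derive_0_is_cst (f := fun t => H t i j)) => t.
  by have /is_derive_mxP/(_ i j) := dH t; rewrite mxE.
move: H_cst; rewrite /H /G subr0 scale0r expmx0 mul1mx => ->.
by rewrite addrAC subrr add0r.
Qed.

Lemma det_expmx B (t : R) : \det (expmx (t *: B)) = expR (t * \tr B).
Proof.
pose h u := \det (expmx (u *: B)) * expR (- \tr B * u).
have dh u : is_derive u (1 : R) h 0.
  have d_det := is_derive_det (is_derive_expmx B u).
  have d_lin : is_derive u (1 : R) (fun u => - \tr B * u) (- \tr B).
    by apply: is_derive_eq (is_deriveZ _ (is_derive_id u 1)) _; exact: mulr1.
  have d_exp := is_derive1_comp (is_derive_expR (- \tr B * u)) d_lin.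
  apply: is_derive_eq (is_deriveM d_det d_exp) _.
  rewrite mulmxA mxtrace_mulC mulmxA mul_mx_adj mul_scalar_mx mxtraceZ.
  by rewrite /GRing.scale/=; ring.
have := is_derive_0_is_cst t 0 dh.
rewrite /h mulr0 expR0 scale0r expmx0 det1 mulr1 mulNr expRN.
by move=> /divr1_eq->; rewrite mulrC.
Qed.

End matrix_exponential.

(** * Lebesgue measure on [R^N] *)

Section lebesgue_Rn_theory.
Context (R : realType) (N : nat).
Local Notation M := (measurableTypeR R).

Lemma borel_measurable_Rn (A : set (N.-tuple M)) :
  measurable A -> measurable (A : set (Rn R N)).
Proof.
move=> mA; apply: (@sub_caratheodory _ _ _ (borel_lebesgue R N)).
exact: sub_sigma_algebra.
Qed.

Lemma lebesgue_Rn_borel (A : set (N.-tuple M)) : measurable A ->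
  lebesgue_Rn R N A = borel_lebesgue R N A.
Proof. by move=> mA; exact: measurable_mu_extE. Qed.

Lemma measurable_Rn_tuple :
  measurable_fun [set: Rn R N] (fun X : Rn R N => X : N.-tuple M).
Proof. by move=> _ A mA; rewrite setTI; exact: borel_measurable_Rn. Qed.

Lemma ge0_integral_lebesgue_Rn (F : N.-tuple M -> \bar R) :
  measurable_fun setT F -> (forall x, 0 <= F x)%E ->
  (\int[lebesgue_Rn R N]_X F X = \int[borel_lebesgue R N]_x F x)%E.
Proof.
move=> mF F0; pose toT (X : Rn R N) : N.-tuple M := X.
have := @ge0_integral_pushforward _ _ _ _ R toT measurable_Rn_tuple
  (lebesgue_Rn R N) setT F measurableT mF (fun x _ => F0 x).
rewrite preimage_setT => <-.
apply: eq_measure_integral => [|mtoT A mA _]; first exact: measurable_Rn_tuple.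
exact: lebesgue_Rn_borel.
Qed.

Lemma sigma_finite_lebesgue_Rn : sigma_finite setT (lebesgue_Rn R N).
Proof. exact/completed_measure_extension_sigma_finite/sigma_finiteT. Qed.

HB.instance Definition _ := Measure_isSigmaFinite.Build _ _ _
  (@completed_measure_extension _ _ _ (borel_lebesgue R N))
  sigma_finite_lebesgue_Rn.

Definition lebesgue_Rn_sigma_finite :
    {sigma_finite_measure set (Rn R N) -> \bar R} :=
  @completed_measure_extension _ _ _ (borel_lebesgue R N).

Definition cube (e : R) : set (Rn R N) :=
  [set X | forall i, `]- e, e[%classic (tnth X i)].

Lemma measurable_cube (e : R) : measurable (cube e : set (N.-tuple M)).
Proof.
have -> : cube e = \bigcap_i ((@tnth N M ^~ i) @^-1` `]- e, e[).
  by apply/seteqP; split => X cubeX i; [move=> _; exact: cubeX|exact: cubeX].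
apply: fin_bigcap_measurable => // i _; rewrite -[X in measurable X]setTI.
by apply: measurable_tnth => //; exact: measurable_itv.
Qed.

Lemma lebesgue_Rn_cube (e : R) : 0 < e ->
  lebesgue_Rn R N (cube e) = ((2 * e) ^+ N)%:E.
Proof.
move=> e0; rewrite lebesgue_Rn_borel; last exact: measurable_cube.
rewrite (@borel_lebesgue_box R N (fun=> `]- e, e[%classic)) => [|i]; last first.
  exact: measurable_itv.
have -> : lebesgue_measure (`]- e, e[%classic : set R) = (2 * e)%:E.
  rewrite lebesgue_measure_itv/= lte_fin gt0_cp// -EFinD; congr EFin; ring.
by rewrite prodEFin prodr_const card_ord.
Qed.

Lemma sqr_coord_le_dotv (v : 'cV[R]_N) i : v i 0 ^+ 2 <= dotv v v.
Proof.
rewrite /dotv (bigD1 i)//= lerDl; apply: sumr_ge0 => j _; exact: sqr_ge0.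
Qed.

Lemma measurable_unit_ball : measurable (@unit_ball R N : set (N.-tuple M)).
Proof.
have mquad := measurable_quadratic 1%:M (0 : 'cV[R]_N).
have -> : @unit_ball R N =
    [set: N.-tuple M] `&` (fun x : N.-tuple M =>
      dotv (1%:M *m (colv x - 0)) (colv x - 0)) @^-1` `]-oo, 1[.
  by apply/seteqP; split => X;
    rewrite /unit_ball /= in_itv/= mul1mx subr0 => // -[].
by apply: mquad => //; exact: measurable_itv.
Qed.

Lemma omega_gt0 : 0 < omega R N.
Proof.
have mB := borel_measurable_Rn measurable_unit_ball.
have mC e := borel_measurable_Rn (measurable_cube e).
apply/fine_gt0/andP; split.
- pose e : R := N.+1%:R^-1; have e0 : 0 < e by rewrite invr_gt0.
  apply: (@lt_le_trans _ _ (lebesgue_Rn R N (cube e))).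
    by rewrite lebesgue_Rn_cube// lte_fin exprn_gt0// mulr_gt0.
  apply: le_measure; rewrite ?inE// => X cubeX.
  rewrite /unit_ball /dotv/=.
  apply: (@le_lt_trans _ _ (\sum_(i < N) e ^+ 2)).
    apply: ler_sum => i _; rewrite mxE -expr2 -real_normK ?num_real//.
    have := cubeX i; rewrite /= in_itv/= => /andP[Xi1 Xi2].
    by rewrite lerXn2r ?nnegrE ?(ltW e0)// ler_norml !ltW.
  rewrite sumr_const card_ord -mulr_natl expr2 mulrA.
  have Ne : N%:R * e < 1 by rewrite ltr_pdivrMr// mul1r ltr_nat.
  have e1 : e <= 1 by rewrite invf_le1// ler1n.
  by apply: le_lt_trans Ne; rewrite ler_piMr// mulr_ge0// ltW.
- apply: (@le_lt_trans _ _ (lebesgue_Rn R N (cube 1))); last first.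
    by rewrite lebesgue_Rn_cube// ltry.
  apply: le_measure; rewrite ?inE// => X ballX i.
  have := sqr_coord_le_dotv (colv X) i; rewrite mxE => /le_lt_trans/(_ ballX).
  by rewrite -real_normK ?num_real// expr_lt1// ltr_norml /= in_itv/=.
Qed.

End lebesgue_Rn_theory.

(** * Covariance matrices and growth of the volume function *)

Section matrix_integral.
Context (R : realType).
Local Notation lebesgue := (@lebesgue_measure R).

Lemma Rintegral_bigsum (D : set R) (I : Type) (r : seq I) (f : I -> R -> R) :
  measurable D -> (forall i, lebesgue.-integrable D (EFin \o f i)) ->
  \int[lebesgue]_(x in D) (\sum_(i <- r) f i x) =
  \sum_(i <- r) \int[lebesgue]_(x in D) f i x.
Proof.
move=> mD intf; elim: r => [|i r IH].
  rewrite big_nil; under eq_Rintegral do rewrite big_nil.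
  by rewrite Rintegral_cst ?mul0r.
rewrite big_cons -IH; under eq_Rintegral do rewrite big_cons.
rewrite RintegralD//.
have -> : EFin \o (fun x => \sum_(j <- r) f j x) =
    (fun x => \sum_(j <- r) (EFin \o f j) x)%E.
  by apply/funext => x /=; rewrite sumEFin.
exact: integrable_sum.
Qed.

Lemma continuous_integrable_itvcc (h : R -> R) (a b : R) : continuous h ->
  lebesgue.-integrable `[a, b] (EFin \o h).
Proof.
move=> ch; apply: continuous_compact_integrable; first exact: segment_compact.
exact: continuous_subspaceT.
Qed.

Definition intmx m n (D : set R) (H : R -> 'M[R]_(m, n)) : 'M[R]_(m, n) :=
  \matrix_(i, j) \int[lebesgue]_(r in D) (H r i j).

Lemma intmx_linear m n p q (D : set R) (L : {linear 'M[R]_(m, n) -> 'M[R]_(p, q)})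
    (H : R -> 'M[R]_(m, n)) : measurable D ->
  (forall i j, lebesgue.-integrable D (EFin \o (fun r => H r i j))) ->
  intmx D (fun r => L (H r)) = L (intmx D H).
Proof.
move=> mD intH.
have entryL (P : 'M[R]_(m, n)) k l :
    L P k l = \sum_ij P ij.1 ij.2 * L (delta_mx ij.1 ij.2) k l.
  rewrite {1}(matrix_sum_delta P) pair_bigA linear_sum summxE/=.
  by apply: eq_bigr => ij _; rewrite linearZ mxE.
apply/matrixP => k l; rewrite entryL mxE.
under eq_Rintegral do rewrite entryL.
rewrite Rintegral_bigsum// => [|ij].
  by apply: eq_bigr => ij _; rewrite RintegralZr// mxE.
exact: integrableZr (intH ij.1 ij.2).
Qed.

Lemma Rintegral_itvcc_cat (h : R -> R) (a b c : R) : continuous h ->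
  a <= b -> b <= c ->
  \int[lebesgue]_(r in `[a, c]) h r =
  \int[lebesgue]_(r in `[a, b]) h r + \int[lebesgue]_(r in `[b, c]) h r.
Proof.
move=> ch ab bc.
have := @Rintegral_itvB R h (BLeft a) (BRight c) b
  (continuous_integrable_itvcc a c ch).
rewrite !bnd_simp => /(_ ab bc); rewrite Rintegral_itv_obnd_cbnd; last first.
  apply: integrableS (continuous_integrable_itvcc b c ch) => //.
  by apply: subset_itvr; rewrite bnd_simp.
by move=> /eqP; rewrite subr_eq addrC => /eqP.
Qed.

Lemma Rintegral_itvcc_shift (h : R -> R) (u a b : R) : continuous h -> a <= b ->
  \int[lebesgue]_(r in `[u + a, u + b]) h r =
  \int[lebesgue]_(r in `[a, b]) h (u + r).
Proof.
move=> ch ab; pose shift r := u + r.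
have dshift x : is_derive x (1 : R) shift 1.
  by rewrite (_ : shift = cst u + id)//; apply: is_derive_eq; rewrite add0r.
have shift' : derive1 shift = cst 1.
  by apply/funext => x; rewrite derive1E derive_val.
have cshift : continuous shift.
  by move=> x; apply: cvgD; [exact: cvg_cst|exact: cvg_id].
rewrite /Rintegral; congr fine.
rewrite (@integration_by_substitution_increasing R shift h a b)//.
- by apply: eq_integral => x _; rewrite shift' /= mulr1.
- by move=> x y _ _ xy; rewrite /shift ltrD2l.
- by rewrite shift' => x _; exact: cst_continuous.
- by rewrite shift'; exact: is_cvg_cst.
- by rewrite shift'; exact: is_cvg_cst.
- split; first by move=> x _; exact: ex_derive.
    by apply: cvg_at_right_filter; exact: cshift.
  by apply: cvg_at_left_filter; exact: cshift.
- exact: continuous_subspaceT.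
Qed.

End matrix_integral.

Section covariance.
Context (R : realType) (N : nat).
Variables Q B : 'M[R]_N.
Hypothesis symQ : Q = Q^T.

Definition covmx (t : R) : 'M[R]_N :=
  intmx `[0, t] (fun r => expmx (r *: B) *m Q *m (expmx (r *: B))^T).

Let integrand (r : R) := expmx (r *: B) *m Q *m (expmx (r *: B))^T.

Let continuous_integrand i j : continuous (fun r => integrand r i j).
Proof.
have cE : continuous (fun r : R => expmx (r *: B)) by exact: continuous_expmx.
move=> r; apply: cvg_mx_entry; apply: cvg_mulmx; last by apply: cvg_trmx; exact: cE.
by apply: cvg_mulmx; [exact: cE|exact: cvg_cst].
Qed.

Lemma scale_Kmx t : 0 < t -> t *: Kmx Q B t = covmx t.
Proof.
move=> t0; rewrite /Kmx scalerA divff ?gt_eqF// scale1r.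
apply/matrixP => i j; rewrite !mxE; apply: eq_Rintegral => r _.
by rewrite trmx_expmx linearZ.
Qed.

Lemma trmx_covmx t : (covmx t)^T = covmx t.
Proof.
apply/matrixP => i j; rewrite !mxE; apply: eq_Rintegral => r _.
transitivity ((integrand r)^T i j); first by rewrite [RHS]mxE.
by rewrite /integrand !trmx_mul trmxK -symQ mulmxA.
Qed.

Lemma covmxD (t u : R) : 0 <= t -> 0 <= u ->
  covmx (u + t) = covmx u + expmx (u *: B) *m covmx t *m (expmx (u *: B))^T.
Proof.
move=> t0 u0; pose E := expmx (u *: B).
have shift : (fun r => integrand (u + r)) =
    (fun r => (mulmxr E^T \o mulmx E) (integrand r)).
  by apply/funext => r; rewrite /integrand /= expmxDl trmx_mul !mulmxA.
have -> : E *m covmx t *m E^T = intmx `[0, t] (fun r => integrand (u + r)).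
  rewrite shift intmx_linear// => i j; apply: continuous_integrable_itvcc.
  exact: continuous_integrand.
apply/matrixP => i j; rewrite [LHS]mxE [RHS]mxE.
rewrite [X in _ = X + _]mxE [X in _ = _ + X]mxE.
have uut : u <= u + t by rewrite lerDl.
have := Rintegral_itvcc_cat (@continuous_integrand i j) u0 uut.
have := Rintegral_itvcc_shift u (@continuous_integrand i j) t0.
by rewrite addr0 => ->.
Qed.

End covariance.

Lemma dyadic_growth (R : realType) (k : nat) (f : R -> R) : 0 <= f 1 ->
  (forall t u, 1 <= t -> t <= u -> f t <= f u) ->
  (forall t, 1 <= t -> 2 ^+ k * f t <= f (t + t)) ->
  forall t, 1 <= t -> (t / 2) ^+ k * f 1 <= f t.
Proof.
move=> f1 f_nd f_double.
have dyadic m : forall t, 1 <= t <= 2 ^+ m -> (t / 2) ^+ k * f 1 <= f t.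
  elim: m => [|m IH] t /andP[t1 tm].
    rewrite expr0 in tm; apply: le_trans (f_nd _ _ (lexx 1) t1).
    by rewrite ler_piMl// exprn_ile1; lra.
  have [t2|t2] := leP t 2.
    apply: le_trans (f_nd _ _ (lexx 1) t1).
    by rewrite ler_piMl// exprn_ile1; lra.
  have half_t : 1 <= t / 2 <= 2 ^+ m by move: tm; rewrite exprS; lra.
  have t21 : 1 <= t / 2 by lra.
  have := f_double _ t21; rewrite -splitr; apply: le_trans.
  have -> : (t / 2) ^+ k = 2 ^+ k * (t / 2 / 2) ^+ k.
    by rewrite -exprMn; congr (_ ^+ _); field.
  by rewrite -mulrA ler_wpM2l ?exprn_ge0// IH.
move=> t t1; apply: (dyadic (Num.truncn t).+1); rewrite t1/=.
apply: (@le_trans _ _ (Num.truncn t).+1%:R); first exact/ltW/truncnS_gt.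
by rewrite -natrX ler_nat ltnW// ltn_expl.
Qed.

Lemma spdmx_vol_gt0 (R : realType) (N : nat) (Q B : 'M[R]_N) (t : R) :
  0 < t -> spdmx (Kmx Q B t) -> 0 < vol Q B t.
Proof.
move=> t0 spdK; rewrite mulr_gt0 ?omega_gt0// sqrtr_gt0.
exact/spdmx_det_gt0/spdmxZ.
Qed.

Section volume_growth.
Context (R : realType) (N : nat) (Q B : 'M[R]_N).
Hypothesis symQ : Q = Q^T.
Hypothesis pdK : forall t : R, 0 < t -> pdmx (Kmx Q B t).
Implicit Types (t u : R).

Lemma KmxE t : 0 < t -> Kmx Q B t = t^-1 *: covmx Q B t.
Proof. by move=> t0; rewrite -scale_Kmx// scalerA mulVf ?gt_eqF// scale1r. Qed.

Lemma spdmx_Kmx t : 0 < t -> spdmx (Kmx Q B t).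
Proof.
by move=> t0; split; [rewrite KmxE// linearZ/= trmx_covmx|exact: pdK].
Qed.

Lemma spdmx_covmx t : 0 < t -> spdmx (covmx Q B t).
Proof. by move=> t0; rewrite -scale_Kmx//; exact/spdmxZ/spdmx_Kmx. Qed.

Lemma volE t : 0 < t -> vol Q B t = omega R N * Num.sqrt (\det (covmx Q B t)).
Proof. by move=> t0; rewrite /vol scale_Kmx. Qed.

Lemma vol_gt0 t : 0 < t -> 0 < vol Q B t.
Proof. by move=> t0; apply: spdmx_vol_gt0 => //; exact: spdmx_Kmx. Qed.

Let spdmx_transported t u : 0 < t ->
  spdmx (expmx (u *: B) *m covmx Q B t *m (expmx (u *: B))^T).
Proof.
move=> t0; apply: spdmx_conj; last exact: spdmx_covmx.
by rewrite unitmxE unitfE det_expmx gt_eqF// expR_gt0.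
Qed.

Lemma det_covmx_le t u : 0 < t -> t <= u ->
  \det (covmx Q B t) <= \det (covmx Q B u).
Proof.
move=> t0; rewrite le_eqVlt => /predU1P[->//|tu].
have ut : 0 < u - t by rewrite subr_gt0.
apply: det_spdmx_le; [exact: spdmx_covmx|exact/spdmx_covmx/(lt_trans t0)|].
have -> : covmx Q B u = covmx Q B (t + (u - t)) by congr covmx; ring.
rewrite covmxD ?(ltW t0) ?(ltW ut)// addrAC subrr add0r.
exact/spdmx_psdmx/spdmx_transported.
Qed.

Hypothesis trB : 0 <= \tr B.

Lemma det_covmx_double t : 0 < t ->
  2 ^+ N * \det (covmx Q B t) <= \det (covmx Q B (t + t)).
Proof.
move=> t0; have det_t := spdmx_det_gt0 (spdmx_covmx t0).
rewrite covmxD ?(ltW t0)//; apply: det_spdmxD_ge.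
- exact: spdmx_covmx.
- exact: spdmx_transported.
rewrite !det_mulmx det_tr det_expmx mulrAC -expRD ler_peMl ?(ltW det_t)//.
by rewrite -expR0 ler_expR addr_ge0// mulr_ge0// ltW.
Qed.

Lemma vol_growth t : 1 <= t -> vol Q B 1 * (t / 2) `^ (N%:R / 2) <= vol Q B t.
Proof.
move=> t1; have t0 : 0 < t by lra.
have t2 : 0 <= t / 2 by rewrite divr_ge0// ltW.
have det_pos u : 0 < u -> 0 < \det (covmx Q B u).
  by move=> u0; exact/spdmx_det_gt0/spdmx_covmx.
have : (t / 2) ^+ N * \det (covmx Q B 1) <= \det (covmx Q B t).
  apply: (dyadic_growth (f := fun u => \det (covmx Q B u))) => // [|u v u1|u u1].
  - exact/ltW/det_pos.
  - by apply: det_covmx_le; lra.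
  - by apply: det_covmx_double; lra.
rewrite !volE// -ler_sqrt ?(ltW (det_pos _ t0))// sqrtrM ?exprn_ge0//.
rewrite -mulrA ler_pM2l ?omega_gt0// mulrC; apply: le_trans.
by rewrite sqrt_exprn.
Qed.

Lemma Sigma_infty_lt_dim (a : R) : 0 < a < N%:R -> Sigma_infty Q B a.
Proof.
move=> /andP[a0 aN]; split=> //; pose c := vol Q B 1 * 2^-1 `^ (N%:R / 2).
have c0 : 0 < c by rewrite mulr_gt0 ?vol_gt0// powR_gt0.
pose r := (N%:R - a) / 2; have r0 : 0 < r by rewrite divr_gt0// subr_gt0.
apply: (@le_lt_trans _ _ (\int[lebesgue_measure]_(t in `[1%R, +oo[)
    ((c^-1)%:E * (t `^ (- (r + 1)))%:E))%E).
  apply: ge0_le_integral_nomeas => t; rewrite /= in_itv/= andbT => t1;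
    have t0 := lt_le_trans ltr01 t1.
    by rewrite lee_fin divr_ge0 ?powR_ge0 ?(ltW (vol_gt0 t0)).
  rewrite -EFinM lee_fin ler_pdivrMr ?vol_gt0// -mulrA ler_pdivlMl//.
  have -> : a / 2 - 1 = - (r + 1) + N%:R / 2 by rewrite /r; field.
  rewrite powRD; last by rewrite (gt_eqF t0) implybT.
  rewrite mulrCA ler_wpM2l ?powR_ge0//; apply: le_trans (vol_growth t1).
  rewrite powRM ?(ltW t0) ?invr_ge0// /c -mulrA.
  by rewrite ler_wpM2l ?(ltW (vol_gt0 _))// mulrC.
rewrite ge0_integralZl_EFin ?invr_ge0 ?(ltW c0)//; last 2 first.
- by move=> t _; rewrite lee_fin powR_ge0.
- by apply/measurable_EFinP/measurable_funTS; exact: measurable_powR.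
by rewrite integral_powRN_itvcy// -EFinM ltry.
Qed.

Lemma dim_infty_ge_dim : (0 < N)%N -> (N%:R%:E <= dim_infty Q B)%E.
Proof.
move=> N0; apply/lee_subgt0Pr => e e0.
have N0' : 0 < N%:R :> R by rewrite ltr0n.
pose a : R := Num.max (N%:R / 2) (N%:R - e).
apply: (@le_trans _ _ a%:E); first by rewrite -EFinB lee_fin le_max lexx orbT.
apply: ereal_sup_ubound; exists a => //; apply: Sigma_infty_lt_dim.
rewrite lt_max gt_max divr_gt0//=; apply/andP; split; lra.
Qed.

End volume_growth.

(** * The heat kernel and the theorem *)

Definition heat_const (R : realType) (N : nat) : R :=
  omega R N * (4 * pi) `^ (- (N%:R / 2)).

Lemma heat_const_gt0 (R : realType) (N : nat) : 0 < heat_const R N.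
Proof. by rewrite mulr_gt0 ?omega_gt0// powR_gt0// mulr_gt0 ?pi_gt0. Qed.

Section heat_kernel.
Context (R : realType) (N : nat) (Q B : 'M[R]_N) (t : R).
Hypothesis t_gt0 : 0 < t.
Hypothesis spdK : spdmx (Kmx Q B t).
Local Notation K := (Kmx Q B t).
Local Notation M := (measurableTypeR R).

Let A : 'M[R]_N := (4 * t)^-1 *: invmx K.

Let spdA : spdmx A.
Proof. by apply: spdmxZ (spdmx_inv spdK); rewrite invr_gt0 mulr_gt0. Qed.

Let heat_const_vol_ge0 : 0 <= heat_const R N / vol Q B t.
Proof.
by rewrite divr_ge0// ltW// ?heat_const_gt0// spdmx_vol_gt0.
Qed.

Lemma heat_kernelE X Y : heat_kernel Q B X Y t =
  heat_const R N / vol Q B t * gaussian A (colv Y - expmx (t *: B) *m colv X).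
Proof.
rewrite /heat_kernel /gaussian; congr (_ * expR (- _)).
rewrite /kernel_dist sqr_sqrtr; last exact/spdmx_psdmx/spdmx_inv.
by rewrite -scalemxAl dotvZl mulrC.
Qed.

Lemma heat_kernel_ge0 X Y : 0 <= heat_kernel Q B X Y t.
Proof. by rewrite heat_kernelE mulr_ge0 ?gaussian_ge0. Qed.

Lemma heat_kernel_le X Y : heat_kernel Q B X Y t <= heat_const R N / vol Q B t.
Proof.
rewrite heat_kernelE ler_piMr// /gaussian.
by rewrite -expR0 ler_expR oppr_le0 (spdmx_psdmx spdA).
Qed.

Lemma measurable_heat_kernel X :
  measurable_fun [set: Rn R N] (fun Y => heat_kernel Q B X Y t).
Proof.
under eq_fun do rewrite heat_kernelE.
apply: measurable_funM; first exact: measurable_cst.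
have /measurable_EFinP mG := measurable_gaussian A (expmx (t *: B) *m colv X).
exact: (measurableT_comp mG (@measurable_Rn_tuple R N)).
Qed.

Lemma integral_heat_kernel X :
  (\int[lebesgue_Rn R N]_Y (heat_kernel Q B X Y t)%:E = 1)%E.
Proof.
pose w := expmx (t *: B) *m colv X; pose c := heat_const R N / vol Q B t.
have mG := measurable_gaussian A w.
have G0 (x : N.-tuple M) : (0 <= (gaussian A (colv x - w))%:E)%E.
  by rewrite lee_fin gaussian_ge0.
under eq_integral do rewrite heat_kernelE EFinM.
rewrite (@ge0_integral_lebesgue_Rn R N
  (fun Y => c%:E * (gaussian A (colv Y - w))%:E)%E).
- rewrite ge0_integralZl_EFin// integral_gaussian// -EFinM; congr EFin.
  have -> : Num.sqrt (pi ^+ N) / Num.sqrt (\det A) =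
      Num.sqrt ((4 * pi) ^+ N) * Num.sqrt (\det (t *: K)) :> R.
    rewrite -sqrtrV ?(ltW (spdmx_det_gt0 spdA))//.
    rewrite -!sqrtrM ?exprn_ge0 ?mulr_ge0 ?pi_ge0//.
    rewrite /A 2!detZ det_inv exprVn invfM !invrK !exprMn; congr Num.sqrt; ring.
  rewrite /c /heat_const /vol sqrt_exprn ?mulr_ge0 ?pi_ge0// powRN.
  have dtK : 0 < \det (t *: K) by exact/spdmx_det_gt0/spdmxZ.
  have p0 : 0 < 4 * pi :> R by rewrite mulr_gt0 ?pi_gt0.
  by field; rewrite !gt_eqF ?omega_gt0 ?powR_gt0 ?sqrtr_gt0.
- exact: measurable_funeM.
- by move=> x; rewrite mule_ge0.
Qed.

End heat_kernel.

Section embedding_and_isoperimetry.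
Context (R : realType) (N : nat) (D0 Dinf s gamma : R) (Q B : 'M[R]_N).
Hypotheses (N_ge2 : (2 <= N)%N) (s_bounds : 0 < s < 1 / 2) (Dinf_D0 : Dinf < D0)
  (gamma_gt0 : 0 < gamma).
Hypothesis symQ : Q = Q^T.
Hypothesis pdK : forall t : R, 0 < t -> pdmx (Kmx Q B t).
Hypothesis trB : 0 <= \tr B.
Hypothesis dim_infty_QB : dim_infty Q B = Dinf%:E.
Hypothesis vol_ge : forall t : R, 0 < t ->
  gamma * dim_profile D0 Dinf t <= vol Q B t.
Local Notation mu := (lebesgue_Rn_sigma_finite R N).

Let p (t : R) (X Y : Rn R N) : R := heat_kernel Q B X Y t.
Let b (t : R) : R := heat_const R N / vol Q B t.
Let a : R := 2 * heat_const R N / gamma.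

Let s_gt0 : 0 < s. Proof. by case/andP: s_bounds. Qed.

Let a_gt0 : 0 < a.
Proof. by rewrite divr_gt0// mulr_gt0// heat_const_gt0. Qed.

Let s_Dinf : 2 * s < Dinf.
Proof.
have : (N%:R <= Dinf :> R).
  by rewrite -lee_fin -dim_infty_QB; exact/dim_infty_ge_dim/ltnW.
have : 2 <= N%:R :> R by rewrite ler_nat.
by case/andP: s_bounds => _; lra.
Qed.

Lemma heat_kernel_markov : bounded_markov_kernel mu p b.
Proof.
move=> t t0; have spdK := spdmx_Kmx symQ pdK t0; split.
- exact: heat_kernel_ge0.
- exact: measurable_heat_kernel.
- exact: integral_heat_kernel.
- exact: heat_kernel_le.
Qed.

Let b_le t : 0 < t -> b t * dim_profile D0 Dinf t <= a / 2.
Proof.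
move=> t0; have V0 := vol_gt0 symQ pdK t0.
rewrite /b mulrAC ler_pdivrMr//.
have -> : a / 2 * vol Q B t = heat_const R N * (vol Q B t / gamma).
  by rewrite /a; field; rewrite gt_eqF.
by rewrite ler_pM2l ?heat_const_gt0// ler_pdivlMr// mulrC vol_ge.
Qed.

Lemma besov_seminorm_nonlocal (f : Rn R N -> R) :
  besov_seminorm Q B (2 * s) 1 f = nonlocal_seminorm mu p s f.
Proof.
rewrite -[RHS]poweRe1 ?(nonlocal_seminorm_ge0 heat_kernel_markov)//.
rewrite /besov_seminorm invr1; apply: (congr1 (fun z => (z `^ 1)%E)).
apply: eq_integral => t _; rewrite (_ : 2 * s * 1 / 2 + 1 = s + 1); last by field.
apply: (congr1 (fun z => (_ * z)%E)).
by apply: eq_integral => X _; apply: eq_integral => Y _; rewrite powRr1.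
Qed.

Let C0 := embedding_const a D0 s.
Let Cinf := embedding_const a Dinf s.

Lemma besov_sum_embedding (f : Rn R N -> R) : besov Q B (2 * s) 1 f ->
  sum_space (sobolev_exponent D0 s) (sobolev_exponent Dinf s) f /\
  (sum_norm (sobolev_exponent D0 s) (sobolev_exponent Dinf s) f <=
   (C0 + Cinf)%:E * besov_seminorm Q B (2 * s) 1 f)%E.
Proof.
rewrite /besov/= besov_seminorm_nonlocal.
move=> [/Lfun1_integrable/integrableP[/measurable_EFinP mf intf] seminorm_fin].
have [f0 [finf [mf0 mfinf fE le_f0 le_finf]]] := nonlocal_sum_embedding
  heat_kernel_markov a_gt0 s_gt0 s_Dinf Dinf_D0 b_le mf intf.
have in_Lfun (D : R) (g : Rn R N -> R) : measurable_fun setT g ->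
    ('N[mu]_((sobolev_exponent D s)%:E)[EFin \o g] <=
     (embedding_const a D s)%:E * nonlocal_seminorm mu p s f)%E ->
    g \in Lfun (lebesgue_Rn R N) (sobolev_exponent D s)%:E.
  move=> mg gle; rewrite inE; apply/andP; split; rewrite inE/= ?inE//.
  apply: (le_lt_trans gle); apply: lte_mul_pinfty => //.
  by rewrite lee_fin ltW// embedding_const_gt0.
have dec : sum_decomposition (sobolev_exponent D0 s) (sobolev_exponent Dinf s) f
    (f0, finf).
  split=> /=; [exact: in_Lfun le_f0|exact: in_Lfun le_finf|].
  by apply: nearW => X _; rewrite fE.
split; first by exists (f0, finf).
apply: (@le_trans _ _ ('N[mu]_((sobolev_exponent D0 s)%:E)[EFin \o f0] +
    'N[mu]_((sobolev_exponent Dinf s)%:E)[EFin \o finf])%E).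
  by apply: ereal_inf_lbound; exists (f0, finf).
rewrite EFinD ge0_muleDl ?lee_fin ?(ltW (embedding_const_gt0 _ _ _))//.
exact: leeD le_f0 le_finf.
Qed.

Lemma perimeter_isoperimetry (E : set (Rn R N)) : measurable E ->
  (lebesgue_Rn R N E < +oo)%E ->
  (Order.min (lebesgue_Rn R N E `^ (sobolev_exponent D0 s)^-1)
             (lebesgue_Rn R N E `^ (sobolev_exponent Dinf s)^-1) <=
   (C0 + Cinf)%:E * perimeter Q B s E)%E.
Proof.
move=> mE Efin; rewrite /perimeter besov_seminorm_nonlocal.
exact: (nonlocal_isoperimetry heat_kernel_markov a_gt0 s_gt0 s_Dinf Dinf_D0 b_le).
Qed.

End embedding_and_isoperimetry.

Theorem theorem1p4 (R : realType) (N : nat) (D0 Dinf s gamma : R)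
    (hN : (2 <= N)%N) (hs : 0 < s < 1 / 2) (hD : Dinf < D0) (hg : 0 < gamma) :
  exists c ct : R, [/\ 0 < c, 0 < ct &
    forall Q B : 'M[R]_N,
      Q = Q^T -> psdmx Q ->
      (forall t : R, 0 < t -> pdmx (Kmx Q B t)) ->
      0 <= \tr B ->
      dim_zero Q B D0 ->
      dim_infty Q B = Dinf%:E ->
      (forall t : R, 0 < t ->
         gamma * Num.min (t `^ (D0 / 2)) (t `^ (Dinf / 2)) <= vol Q B t) ->
      (forall f : Rn R N -> R, besov Q B (2 * s) 1 f ->
         sum_space (D0 / (D0 - 2 * s)) (Dinf / (Dinf - 2 * s)) f /\
         (sum_norm (D0 / (D0 - 2 * s)) (Dinf / (Dinf - 2 * s)) f
            <= (c^-1)%:E * besov_seminorm Q B (2 * s) 1 f)%E) /\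
      (forall E : set (Rn R N), measurable E ->
         (lebesgue_Rn R N E < +oo)%E ->
         (ct%:E * Order.min (lebesgue_Rn R N E `^ ((D0 - 2 * s) / D0))
                            (lebesgue_Rn R N E `^ ((Dinf - 2 * s) / Dinf))
            <= perimeter Q B s E)%E)].
Proof.
pose a := 2 * heat_const R N / gamma.
pose C := embedding_const a D0 s + embedding_const a Dinf s.
have a0 : 0 < a by rewrite divr_gt0// mulr_gt0// heat_const_gt0.
have C0 : 0 < C by case/andP: hs => s0 _; rewrite addr_gt0// embedding_const_gt0.
exists C^-1, C^-1; split; rewrite ?invr_gt0// => Q B symQ _ pdK trB _ dim_QB vol_ge.
split=> [f besov_f|E mE Efin].
  rewrite invrK.
  exact: (besov_sum_embedding hN hs hD hg symQ pdK trB dim_QB vol_ge besov_f).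
have := perimeter_isoperimetry hN hs hD hg symQ pdK trB dim_QB vol_ge mE Efin.
by rewrite /sobolev_exponent !invf_div -lee_pdivrMl.
Qed.
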